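(* For $r\in\{2,\dots,n-1\}$: $K[\mathcal P_r]$ is Cohen–Macaulay if and only if $r\le m_1$ or $r=n-1$.
   Context: $K$ is an infinite field, $n\ge4$, and $m_1<\dots<m_n$ is an arithmetic sequence of relatively prime positive integers: $m_i=m_1+(i-1)d$ with $m_1,d\in\mathbb Z^+$ and $\gcd\{m_1,d\}=1$. Let $a_i=(m_i,m_n-m_i)\in\mathbb N^2$ for $1\le i\le n-1$, $a_n=(m_n,0)$, $a_{n+1}=(0,m_n)$. For $r\in\{2,\dots,n-1\}$, $\mathcal P_r\subset\mathbb N^2$ is the semigroup (with $0$) generated by $\{a_1,\dots,a_{n+1}\}\setminus\{a_r\}$ and $K[\mathcal P_r]=K[t^s\mid s\in\mathcal P_r]$. *)

(* Defs.v *)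
From HB Require Import structures.
From mathcomp Require Import all_boot all_order all_algebra.
From mathcomp Require Import boolp.
From mathcomp Require Import mpoly.
Set Implicit Arguments.
Unset Strict Implicit.
Unset Printing Implicit Defensive.
Import GRing.Theory.
Local Open Scope ring_scope.

Section CohenMacaulay.
Variable R : comNzRingType.
Implicit Types (I P : {pred R}) (s : seq R).

Definition in_ideal_gen s (x : R) : Prop :=
  exists c : nat -> R, x = \sum_(i < size s) c i * s`_i.

(* [idealr_closed] requires 1 \notin I, so it describes the proper ideals; this
   loses nothing here, the unit ideal being generated by 1.  Boolean-valued
   ideals cover all ideals, by [asbool]. *)
Definition noetherian : Prop :=
  forall I, idealr_closed I ->
    exists s : seq R, forall x, x \in I <-> in_ideal_gen s x.

Definition is_prime_ideal P : Prop := idealr_closed P /\ prime_idealr_closed P.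

Definition is_maximal_ideal P : Prop :=
  idealr_closed P /\
  forall I, idealr_closed I -> {subset P <= I} -> {subset I <= P}.

Definition regular_seq s : Prop :=
  ~ in_ideal_gen s 1 /\
  forall i, (i < size s)%N ->
    forall y, in_ideal_gen (take i s) (s`_i * y) -> in_ideal_gen (take i s) y.

Definition is_depth I (k : nat) : Prop :=
  (exists s, [/\ regular_seq s, {subset s <= I} & size s = k]) /\
  (forall s, regular_seq s -> {subset s <= I} -> (size s <= k)%N).

Definition prime_chain_to P (k : nat) (c : nat -> {pred R}) : Prop :=
  [/\ c k =i P,
      forall i, (i <= k)%N -> is_prime_ideal (c i)
    & forall i, (i < k)%N ->
        {subset c i <= c i.+1} /\ ~ {subset c i.+1 <= c i}].

Definition is_height P (k : nat) : Prop :=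
  (exists c, prime_chain_to P k c) /\
  (forall l c, prime_chain_to P l c -> (l <= k)%N).

(* depth P, the length of a longest regular sequence of R inside the maximal
   ideal P, is the depth of the local ring R_P, and height P is its dimension;
   both are finite when R is noetherian. *)
Definition cohen_macaulay : Prop :=
  noetherian /\
  forall P, is_maximal_ideal P -> exists k, is_depth P k /\ is_height P k.

End CohenMacaulay.

Definition submonoid_gen (N : nat) (A : seq 'X_{1..N}) : {pred 'X_{1..N}} :=
  fun s => `[< exists c : 'X_{1..N} -> nat, s = (\sum_(a <- A) a *+ c a)%MM >].

(* K[S] as a subring of the polynomial ring, for S the monoid generated by A:
   the polynomials all of whose monomials t^s have s in S. *)
Section SemigroupRing.
Variables (K : fieldType) (N : nat) (A : seq 'X_{1..N}).

Definition semigroup_supp : {pred {mpoly K[N]}} :=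
  fun f => all (mem (submonoid_gen A)) (msupp f).

Lemma submonoid_gen0 : 0%MM \in submonoid_gen A.
Proof.
apply/asboolP; exists (fun=> 0%N).
by rewrite big1.
Qed.

Lemma submonoid_genD s t : s \in submonoid_gen A -> t \in submonoid_gen A ->
  (s + t)%MM \in submonoid_gen A.
Proof.
move=> /asboolP[c ->] /asboolP[e ->]; apply/asboolP.
exists (fun a => (c a + e a)%N); rewrite -big_split /=; apply: eq_bigr => a _.
by apply/mnmP=> i; rewrite mnmDE !mulmnE mulnDr.
Qed.

Lemma semigroup_supp_subring : subring_closed semigroup_supp.
Proof.
split=> [|f g /allP fS /allP gS|f g /allP fS /allP gS]; apply/allP=> s.
- by rewrite msupp1 inE => /eqP ->; apply: submonoid_gen0.
- by move/msuppB_le; rewrite mem_cat => /orP[/fS|/gS].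
- move/msuppM_le/allpairsP=> [[u v] /= [/fS uS /gS vS ->]].
  exact: submonoid_genD.
Qed.

HB.instance Definition _ :=
  GRing.isSubringClosed.Build {mpoly K[N]} semigroup_supp semigroup_supp_subring.

Record semigroup_ring : Type := SemigroupRing {
  semigroup_ring_val :> {mpoly K[N]};
  _ : semigroup_ring_val \in semigroup_supp
}.

HB.instance Definition _ := [isSub for semigroup_ring_val].
HB.instance Definition _ := [Choice of semigroup_ring by <:].
HB.instance Definition _ := [SubChoice_isSubComNzRing of semigroup_ring by <:].

End SemigroupRing.

Section ProjectiveMonomialCurve.
Variables (n m1 d : nat).

Definition arith_seq (i : nat) : nat := m1 + (i - 1) * d.

(* The point a_i of N^2, for 1 <= i <= n+1. *)
Definition curve_gen (i : nat) : 'X_{1..2} :=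
  let m := arith_seq in
  if (i <= n)%N then [multinom [tuple m i; m n - m i]%N]
  else [multinom [tuple 0; m n]%N].

Definition curve_gens : seq 'X_{1..2} := [seq curve_gen i | i <- iota 1 n.+1].

Definition curve_gens_but (r : nat) : seq 'X_{1..2} :=
  [seq a <- curve_gens | a != curve_gen r].

End ProjectiveMonomialCurve.

(* Main.v *)
Require Import Defs.
From HB Require Import structures.
From mathcomp Require Import all_boot all_order all_algebra.
From mathcomp Require Import boolp classical_sets cardinality.
From mathcomp Require Import mpoly.
From mathcomp Require Import zify ring.
Set Implicit Arguments.
Unset Strict Implicit.
Unset Printing Implicit Defensive.
Import Order.TTheory GRing.Theory.

(* Write N = n - 1, rho = r - 1 and m = m_n, let S be the semigroup, and let
   u = x^m and v = y^m be the monomials of its two extremal generators.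

   K[S] is Cohen-Macaulay iff S satisfies: s + i(m, 0) in S and s + j(0, m) in S
   imply s in S.  If the condition holds, then every maximal ideal P contains
   nonzero polynomials f(u) and g(v), by Zariski's lemma, and these form a
   regular sequence: in K[x, y] they are coprime, and the condition on S brings
   the quotients back to K[S].  A regular sequence of length 2 yields a chain of
   primes of length 2, and neither a regular sequence nor a chain can be longer,
   since either one gives as many algebraically independent elements of K[x, y].
   Conversely, if h is not in S but h + a is in S for each generator a, then for
   f, g in the maximal ideal at the origin, g (f t^h) = f (g t^h) shows that f, g
   is not a regular sequence, while that ideal has height 2.

   A point of S of degree D has abscissa j m_1 + e d, where j <= D and e is a sum
   of j elements of {0, ..., N} without rho.  Such sums fill [0, jN] up to the
   value rho for j = 1, the value 1 when rho = 1 and the value jN - 1 when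
   rho = N - 1.  As gcd (m_1, d) = 1, (j, e) is unique up to multiples of
   (d, -m_1), and a missing value spoils the condition on S exactly when the
   exchange of (j, rho) for (j + d, rho - m_1) is possible and rho < N - 1. *)

(** * Points of N^2 and the submonoids they generate *)

Definition mnm2 (x y : nat) : 'X_{1..2} := [multinom [tuple x; y]].

Lemma mnm2_0 x y : mnm2 x y ord0 = x.
Proof. by rewrite multinomE (tnth_nth 0). Qed.

Lemma mnm2_1 x y : mnm2 x y ord_max = y.
Proof. by rewrite multinomE (tnth_nth 0). Qed.

Lemma mnm2P (s t : 'X_{1..2}) : s ord0 = t ord0 -> s ord_max = t ord_max -> s = t.
Proof.
move=> h0 h1; apply/mnmP; case=> [[|[|//]] i].
- by rewrite (_ : Ordinal i = ord0) //; apply: val_inj.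
- by rewrite (_ : Ordinal i = ord_max) //; apply: val_inj.
Qed.

Definition mnm2E := (mnm2_0, mnm2_1, @mnmDE 2, @mulmnE 2, @mnm0E 2).

Lemma submonoid_gen_ind N (A : seq 'X_{1..N}) (P : 'X_{1..N} -> Prop) :
    P 0%MM -> (forall s t, P s -> P t -> P (s + t)%MM) ->
    (forall a, a \in A -> P a) ->
  forall s, s \in submonoid_gen A -> P s.
Proof.
move=> P0 PD PA s /asboolP[c ->]; rewrite big_seq_cond.
apply: big_ind => // a /andP[/PA Pa _].
elim: (c a) => [|k IH]; first by rewrite mulm0n.
by rewrite mulmS; apply: PD.
Qed.

(** The coefficient c is a function of the generator and not of its position, so a repeated
    generator would be counted twice; hence [uniq]. *)
Lemma submonoid_gen_mem N (A : seq 'X_{1..N}) a :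
  uniq A -> a \in A -> a \in submonoid_gen A.
Proof.
move=> uA aA; apply/asboolP; exists (fun b => b == a : nat).
rewrite (bigD1_seq a) //= eqxx mulm1n big1 ?addm0 // => b /negPf ->.
by rewrite mulm0n.
Qed.

Lemma submonoid_gen_mulmn N (A : seq 'X_{1..N}) s k :
  s \in submonoid_gen A -> (s *+ k)%MM \in submonoid_gen A.
Proof.
move=> sA; elim: k => [|k IH]; first by rewrite mulm0n submonoid_gen0.
by rewrite mulmS submonoid_genD.
Qed.

Local Open Scope ring_scope.

(** * Independence, dimension and depth *)

Section Ideals.
Variable R : comNzRingType.
Implicit Types I : R -> Prop.

(** Unlike [idealr_closed], this admits the unit ideal and propositional predicates, so generated
    ideals fit without a case distinction. *)
Definition ideal I := I 0 /\ forall a x y, I x -> I y -> I (a * x + y).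

Variable I : R -> Prop.
Hypothesis idI : ideal I.

Lemma ideal0 : I 0. Proof. by case: idI. Qed.

Lemma idealMl a x : I x -> I (a * x).
Proof. by move=> Ix; rewrite -[_ * _]addr0; apply: (idI.2) => //; apply: ideal0. Qed.

Lemma idealMr a x : I x -> I (x * a).
Proof. by rewrite mulrC; apply: idealMl. Qed.

Lemma idealD x y : I x -> I y -> I (x + y).
Proof. by move=> Ix Iy; rewrite -[x]mul1r; apply: (idI.2). Qed.

Lemma idealN x : I x -> I (- x).
Proof. by move=> Ix; rewrite -mulN1r; apply: idealMl. Qed.

Lemma idealB x y : I x -> I y -> I (x - y).
Proof. by move=> Ix Iy; apply: idealD => //; apply: idealN. Qed.

Lemma ideal_sum (T : Type) (s : seq T) (P : pred T) (F : T -> R) :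
  (forall t, P t -> I (F t)) -> I (\sum_(t <- s | P t) F t).
Proof. by move=> IF; apply: big_ind => //; [apply: ideal0|apply: idealD]. Qed.

End Ideals.

Section IdealPredicates.
Variable R : comNzRingType.

Lemma idealr_ideal (P : {pred R}) : idealr_closed P -> ideal (fun x => x \in P).
Proof. by case=> P0 _ PD; split=> // a x y Px Py; apply: PD. Qed.

Lemma ideal_idealr (I : R -> Prop) :
  ideal I -> ~ I 1 -> idealr_closed (fun x => `[< I x >] : bool).
Proof.
move=> [I0 ID] I1; split; [exact/asboolP|exact/asboolP|].
by move=> a x y /asboolP Ix /asboolP Iy; apply/asboolP/ID.
Qed.

Lemma ideal_gen (s : seq R) : ideal (in_ideal_gen s).
Proof.
split; first by exists (fun=> 0); rewrite big1 // => i _; rewrite mul0r.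
move=> a x y [c ->] [e ->]; exists (fun i => a * c i + e i).
by rewrite mulr_sumr -big_split /=; apply: eq_bigr => i _; rewrite mulrDl mulrA.
Qed.

Lemma ideal_gen_sub (s : seq R) (I : R -> Prop) : ideal I ->
  (forall x, x \in s -> I x) -> forall x, in_ideal_gen s x -> I x.
Proof.
move=> idI sI x [c ->]; apply: ideal_sum => // i _; apply: idealMl => //.
by apply: sI; rewrite mem_nth.
Qed.

Lemma ideal_gen_mem (s : seq R) x : x \in s -> in_ideal_gen s x.
Proof.
move=> xs; exists (fun i => (i == index x s)%:R).
have xlt : (index x s < size s)%N by rewrite index_mem.
rewrite (bigD1 (Ordinal xlt)) //= eqxx mul1r nth_index // big1 ?addr0 // => i.
by rewrite -val_eqE /= => /negPf ->; rewrite mul0r.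
Qed.

Lemma ideal_gen_nil (x : R) : in_ideal_gen [::] x <-> x = 0.
Proof.
split; first by case=> c ->; rewrite big_ord0.
by move=> ->; apply: (ideal0 (ideal_gen _)).
Qed.

Lemma ideal_gen1 (f x : R) : in_ideal_gen [:: f] x <-> exists y, x = f * y.
Proof.
split=> [[c]|[y ->]]; last by apply/(idealMr (ideal_gen _))/ideal_gen_mem/mem_head.
by rewrite big_ord1 => ->; exists (c 0%N); rewrite mulrC.
Qed.

(** Modulo I' only the term a = 0 survives, so g 0 vanishes; what remains is a multiple of f, and f
    cancels modulo I. This is one step of algebraic independence along a flag of ideals. *)
Lemma sum_powers_inj (I I' : R -> Prop) (f : R) (g : nat -> R) (J : nat) :
    ideal I -> ideal I' -> (forall x, I x -> I' x) -> I' f ->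
    (forall y, I (f * y) -> I y) ->
    (forall a, (a < J)%N -> I' (g a) -> g a = 0) ->
    I (\sum_(a < J) f ^+ a * g a) ->
  forall a, (a < J)%N -> g a = 0.
Proof.
move=> idI idI' II' I'f If; elim: J g => [//|J IH] g g0.
have E : \sum_(a < J.+1) f ^+ a * g a = g 0%N + f * \sum_(a < J) f ^+ a * g a.+1.
  rewrite big_ord_recl expr0 mul1r mulr_sumr; congr (_ + _).
  by apply: eq_bigr => i _; rewrite lift0 exprS mulrA.
rewrite E => IE.
have g00 : g 0%N = 0.
  apply: g0 => //; have /(idealB idI') := II' _ IE.
  by move/(_ _ (idealMr idI' (\sum_(a < J) f ^+ a * g a.+1) I'f)); rewrite addrK.
rewrite g00 add0r in IE; have {}IE := If _ IE.
have IH' := IH (fun a => g a.+1) (fun a aJ => g0 a.+1 aJ) IE.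
by case=> [//|a] aJ; apply: IH'.
Qed.

End IdealPredicates.

(** Only the B^2 monomials x^a y^b with a, b < B can occur, so the coefficient matrix has more rows
    than columns. *)
Lemma lin_dep (K : fieldType) (T : finType) (B : nat) (F : T -> {mpoly K[2]}) :
    (forall t, (msize (F t) <= B)%N) -> (B * B < #|T|)%N ->
  exists c : T -> K, (exists t, c t != 0) /\ \sum_t c t *: F t = 0.
Proof.
move=> FB BT.
pose M := \matrix_(i < #|T|)
  mxvec (\matrix_(a < B, b < B) (F (enum_val i))@_(mnm2 a b)).
have : kermx M != 0.
  rewrite kermx_eq0; apply/negP => /eqP rM; move: BT.
  by rewrite -rM ltnNge rank_leq_col.
case/rowV0Pn => v /sub_kermxP vM v0.
exists (fun t => v 0 (enum_rank t)); split.
  apply/existsP; apply: contraNT v0 => /existsPn h; apply/eqP/rowP => i.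
  by rewrite mxE; have /negPn/eqP := h (enum_val i); rewrite enum_valK.
apply/mpolyP => s; rewrite mcoeff0 raddf_sum /=.
have [sB|sB] := leqP B (mdeg s).
  apply: big1 => t _; rewrite mcoeffZ memN_msupp_eq0 ?mulr0 //.
  by apply: msize_mdeg_ge; apply: leq_trans sB.
have sd : (s ord0 + s ord_max = mdeg s)%N.
  by rewrite mdegE big_ord_recl big_ord1; congr (_ + s _)%N; apply: val_inj.
have s0 : (s ord0 < B)%N by lia.
have s1 : (s ord_max < B)%N by lia.
have := congr1 (fun w : 'rV_(B * B) => w 0 (mxvec_index (Ordinal s0) (Ordinal s1))) vM.
rewrite !mxE => E; apply: etrans E; rewrite (reindex (@enum_val T T)) /=; last first.
  by apply: onW_bij; apply: enum_val_bij.
apply: eq_bigr => i _; rewrite enum_valK mcoeffZ !mxE mxvecE mxE /=.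
by congr (_ * _@__); apply: mnm2P; rewrite !mnm2E.
Qed.

Lemma msizeM_leD (K : fieldType) n (p q : {mpoly K[n]}) :
  (msize (p * q) <= msize p + msize q)%N.
Proof.
have [->|p0] := eqVneq p 0; first by rewrite mul0r msize0.
have [->|q0] := eqVneq q 0; first by rewrite mulr0 msize0.
by rewrite msizeM // leq_pred.
Qed.

Lemma msizeX_leD (K : fieldType) n (p : {mpoly K[n]}) a :
  (msize (p ^+ a) <= a * msize p + 1)%N.
Proof.
elim: a => [|a IH]; first by rewrite expr0 msize1.
by rewrite exprS mulSn -addnA (leq_trans (msizeM_leD _ _)) // leq_add2l.
Qed.

Section Dimension.
Variables (K : fieldType) (R : comNzRingType).
Variables (val : {rmorphism R -> {mpoly K[2]}}) (io : {rmorphism K -> R}).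
Hypotheses (val_inj : injective val) (val_io : forall c, val (io c) = c%:MP).

(* Such f 0, f 1, f 2 are algebraically independent over K modulo I 0, but
   K[x, y] has too few monomials of bounded degree for three such elements. *)
Lemma ideal_flag_lt3 (I : nat -> R -> Prop) (f : nat -> R) :
    (forall i, (i <= 3)%N -> ideal (I i)) -> ~ I 3 1 ->
    (forall i, (i < 3)%N -> [/\ forall x, I i x -> I i.+1 x, I i.+1 (f i)
      & forall y, I i (f i * y) -> I i y]) -> False.
Proof.
move=> idI I31 fI.
pose D := (msize (val (f 0%N)) + msize (val (f 1%N)) + msize (val (f 2%N)))%N.
pose B J := (J.+1 * D + 3)%N.
(* There are (J + 1)^3 products of powers, of size at most B J <= (J + 1)(D + 3); so J = (D + 3)^2
   makes them outnumber the (B J)^2 monomials. *)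
have [J JB] : exists J, (B J * B J < J.+1 * (J.+1 * J.+1))%N.
  exists ((D + 3) * (D + 3))%N; rewrite /B; set E := ((D + 3) * (D + 3))%N.
  have le1 : (E.+1 * D + 3 <= E.+1 * (D + 3))%N by rewrite mulnDr leq_add2l; lia.
  apply: leq_ltn_trans (leq_mul le1 le1) _.
  by rewrite mulnACA -/E [ltnRHS]mulnA ltn_pmul2l ?muln_gt0.
pose T := ('I_J.+1 * ('I_J.+1 * 'I_J.+1))%type.
pose F (t : T) := f 0%N ^+ t.1 * (f 1%N ^+ t.2.1 * f 2%N ^+ t.2.2).
have [|| c [[t ct] cF]] := @lin_dep K T (B J) (fun t => val (F t)).
- move=> [a [b e]]; rewrite /F !rmorphM !rmorphXn /=.
  apply: leq_trans (msizeM_leD _ _) _.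
  apply: leq_trans (leq_add (msizeX_leD _ _)
    (leq_trans (msizeM_leD _ _) (leq_add (msizeX_leD _ _) (msizeX_leD _ _)))) _.
  have aJ := ltn_ord a; have bJ := ltn_ord b; have eJ := ltn_ord e.
  have le (x : 'I_J.+1) k : (x * k <= J.+1 * k)%N by rewrite leq_mul2r ltnW ?orbT.
  have := le a (msize (val (f 0%N))); have := le b (msize (val (f 1%N))).
  by have := le e (msize (val (f 2%N))); rewrite /B /D !mulnDr; lia.
- by rewrite !card_prod !card_ord.
(* The dependence is read as a polynomial in f 0 whose coefficients are polynomials in f 1, and
   theirs in f 2; each level is cleared in turn. At the bottom, a nonzero constant in I 3 would be a
   unit. *)
pose g2 a b e := io (c (inord a, (inord b, inord e)) : K).
pose g1 a b := \sum_(e < J.+1) f 2%N ^+ e * g2 a b e.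
pose g0 a := \sum_(b < J.+1) f 1%N ^+ b * g1 a b.
have S0 : \sum_(a < J.+1) f 0%N ^+ a * g0 a = 0.
  apply: val_inj; rewrite rmorph0 -cF.
  pose G (a b e : 'I_J.+1) :=
    f 0%N ^+ a * (f 1%N ^+ b * (f 2%N ^+ e * io (c (a, (b, e))))).
  transitivity (val (\sum_(a < J.+1) \sum_(x : 'I_J.+1 * 'I_J.+1) G a x.1 x.2)).
    congr (val _); apply: eq_bigr => a _; rewrite mulr_sumr.
    rewrite -(pair_bigA _ (G a)); apply: eq_bigr => b _; rewrite !mulr_sumr.
    by apply: eq_bigr => e _; rewrite /g2 !inord_val.
  rewrite (pair_bigA _ (fun a x => G a x.1 x.2)) rmorph_sum.
  apply: eq_bigr => [[a [b e]]] _.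
  by rewrite -mul_mpolyC -val_io -rmorphM; congr (val _); rewrite /G /F /=; ring.
have [I01 I1f r0] := fI 0%N isT; have [I12 I2f r1] := fI 1%N isT.
have [I23 I3f r2] := fI 2%N isT.
have g2P a b e : I 3 (g2 a b e) -> g2 a b e = 0.
  rewrite /g2; set k := c _; have [->|k0] := eqVneq k 0; first by rewrite rmorph0.
  move=> /(idealMl (idI 3 isT) (io k^-1)).
  by rewrite -rmorphM mulVf // rmorph1.
have id0 := idI 0%N isT; have id1 := idI 1%N isT.
have id2 := idI 2%N isT; have id3 := idI 3%N isT.
have g1P a b : I 2%N (g1 a b) -> forall e, (e < J.+1)%N -> g2 a b e = 0.
  by move=> h; apply: (sum_powers_inj id2 id3 I23 I3f r2 _ h) => e _; apply: g2P.
have g1Z a b : I 2%N (g1 a b) -> g1 a b = 0.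
  by move=> /g1P h; rewrite /g1 big1 // => e _; rewrite h ?mulr0.
have g0P a : I 1%N (g0 a) -> forall b, (b < J.+1)%N -> g1 a b = 0.
  by move=> h; apply: (sum_powers_inj id1 id2 I12 I2f r1 _ h) => e _; apply: g1Z.
have g0Z a : I 1%N (g0 a) -> g0 a = 0.
  by move=> /g0P h; rewrite /g0 big1 // => e _; rewrite h ?mulr0.
have Sz : forall a, (a < J.+1)%N -> g0 a = 0.
  apply: (sum_powers_inj id0 id1 I01 I1f r0 (fun a _ => g0Z a)).
  by rewrite S0; apply: ideal0.
move: t ct => [a [b e]] /eqP; apply.
have z1 : g1 a b = 0 by apply: g0P => //; rewrite Sz //; apply: ideal0.
have z2 : g2 a b e = 0 by apply: g1P => //; rewrite z1; apply: ideal0.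
have := congr1 val z2; rewrite /g2 !inord_val val_io rmorph0 => /eqP.
by rewrite mpolyC_eq0 => /eqP.
Qed.

End Dimension.

(** * Prime ideals avoiding a multiplicative set, and chains below a maximal ideal *)

Section Primes.
Variable R : comNzRingType.

Lemma idealr_addmul (I : R -> Prop) (u : R) :
  ideal I -> ideal (fun x => exists m a, I m /\ x = m + a * u).
Proof.
move=> idI; split; first by exists 0, 0; rewrite mul0r addr0; split=> //; apply: ideal0.
move=> b x y [m [a [Im ->]]] [k [e [Ik ->]]].
exists (b * m + k), (b * a + e); split; first exact: idI.2.
ring.
Qed.

(** An ideal maximal among those that contain I and miss T is prime: if u and v lie outside it,
    adjoining either one meets T, and the product of the two elements met stays in the ideal as soon
    as u v does. *)
Lemma exists_prime_avoiding (I T : R -> Prop) :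
    ideal I -> T 1 -> (forall x y, T x -> T y -> T (x * y)) ->
    (forall x, I x -> ~ T x) ->
  exists Q : {pred R}, [/\ is_prime_ideal Q, forall x, I x -> x \in Q
    & forall x, x \in Q -> ~ T x].
Proof.
move=> idI T1 TM IT.
(* Zorn's lemma also quantifies over the empty chain, whose union is empty and not an ideal; joining
   I to every set repairs this. *)
pose U (B : set R) (x : R) := I x \/ B x.
pose ok (B : R -> Prop) := ideal B /\ forall x, B x -> ~ T x.
have [F Fok Ftot|B [okB Bmax]] := @Zorn_bigcup R (fun B => ok (U B)).
  split; last first.
    by move=> x [|[X FX Xx]]; [apply: IT|apply: (Fok X FX).2; right].
  split; first by left; apply: ideal0.
  move=> a x y [Ix|[X FX Xx]] [Iy|[Y FY Yy]].
  - by left; apply: idI.2.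
  - have [||h|h] := (Fok Y FY).1.2 a x y; [by left|by right|by left|].
    by right; exists Y.
  - have [||h|h] := (Fok X FX).1.2 a x y; [by right|by left|by left|].
    by right; exists X.
  - have [Z FZ [XZ YZ]] : exists2 Z, F Z & (X `<=` Z)%classic /\ (Y `<=` Z)%classic.
      by case: (Ftot X Y FX FY) => h; [exists Y|exists X] => //; split=> // ?.
    have [||h|h] := (Fok Z FZ).1.2 a x y; [right; exact: XZ|right; exact: YZ|by left|].
    by right; exists Z.
have [idU UT] := okB.
have U1 : ~ U B 1 by move=> /UT.
have max (J : R -> Prop) u : ideal J -> (forall x, U B x -> J x) -> J u ->
    ~ U B u -> exists2 t, J t & T t.
  move=> idJ UJ Ju Uu; apply: contrapT => nT; apply: (Bmax J).
    split; first by move=> x Bx; apply: UJ; right.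
    by move=> /(_ u Ju) Bu; apply: Uu; right.
  have -> : U J = J.
    by apply/funext => x; apply/propext; split=> [[Ix|//]|]; [apply: UJ; left|right].
  by split=> // x Jx Tx; apply: nT; exists x.
exists (fun x => `[< U B x >] : bool); split; last 2 first.
- by move=> x Ix; apply/asboolP; left.
- by move=> x /asboolP/UT.
split; first exact: ideal_idealr.
move=> u v /asboolP Uuv; apply: contrapT => /negP; rewrite negb_or.
move=> /andP[/asboolP Uu /asboolP Uv].
have ext w : ~ U B w -> exists t m a, [/\ T t, U B m & t = m + a * w].
  move=> Uw; have [||t [m [a [Um ->]]] Tt] := max _ w (idealr_addmul w idU) _ _ Uw.
  - by move=> x Ux; exists x, 0; rewrite mul0r addr0.
  - by exists 0, 1; rewrite mul1r add0r; split=> //; apply: ideal0.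
  - by exists (m + a * w), m, a.
have [t [m [a [Tt Um te]]]] := ext u Uu.
have [t' [m' [a' [Tt' Um' te']]]] := ext v Uv.
apply: (UT (t * t')); last exact: TM.
rewrite te te' (_ : _ * _ = m * (m' + a' * v) + (a * u * m' + a * a' * (u * v))).
  by apply: idealD => //; [apply: idealMr|apply: idealD => //; apply: idealMl].
ring.
Qed.

Lemma maximal_inv (P : {pred R}) x : is_maximal_ideal P -> x \notin P ->
  exists w, x * w - 1 \in P.
Proof.
move=> [idP Pmax] xP; have idP' := idealr_ideal idP.
apply: contrapT => nw; have idJ := idealr_addmul x idP'.
have J1 : ~ exists m a, m \in P /\ 1 = m + a * x.
  move=> [m [a [mP E]]]; apply: nw; exists a.
  by rewrite E mulrC opprD addrCA subrr addr0; apply: (idealN idP').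
apply/negP: xP; rewrite negbK; apply: (Pmax _ (ideal_idealr idJ J1)).
  by move=> y yP; apply/asboolP; exists y, 0; rewrite mul0r addr0.
by apply/asboolP; exists 0, 1; rewrite mul1r add0r; split=> //; apply: (ideal0 idP').
Qed.

Lemma maximal_prime (P : {pred R}) : is_maximal_ideal P -> is_prime_ideal P.
Proof.
move=> maxP; split; first exact: maxP.1.
have idP := idealr_ideal maxP.1.
move=> u v uvP; apply: contrapT => /negP; rewrite negb_or.
move=> /andP[uP /negP]; apply; have [w wP] := maximal_inv maxP uP.
have -> : v = (u * v) * w - (u * w - 1) * v by ring.
by apply: (idealB idP); [apply: (idealMr idP)|apply: (idealMr idP)].
Qed.

Hypothesis dom : forall x y : R, x * y = 0 -> x = 0 \/ y = 0.

(** The chain is 0, Q, P, where Q contains f and avoids all s g^k with s outside P. Such products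
    miss (f) because g cancels modulo (f); k = 0 puts Q inside P, and s = k = 1 keeps g out of Q. *)
Lemma regular_height_ge2 (P : {pred R}) (f g : R) : is_maximal_ideal P ->
    regular_seq [:: f; g] -> f \in P -> g \in P ->
  exists c, prime_chain_to P 2 c.
Proof.
move=> maxP [_ reg] fP gP; have [idrP primP] := maximal_prime maxP.
have idP := idealr_ideal idrP.
have f0 : f <> 0.
  move=> f0; have := reg 0%N isT 1; rewrite /= f0 mul0r !ideal_gen_nil.
  by move=> /(_ erefl)/eqP; rewrite oner_eq0.
have gR k x : in_ideal_gen [:: f] (x * g ^+ k) -> in_ideal_gen [:: f] x.
  elim: k x => [|k IH] x; first by rewrite expr0 mulr1.
  by rewrite exprSr mulrA => h; apply/IH/(reg 1%N isT); rewrite mulrC.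
pose T x := exists s k, s \notin P /\ x = s * g ^+ k.
have [||||Q [prQ IQ QT]] := @exists_prime_avoiding (in_ideal_gen [:: f]) T.
- exact: ideal_gen.
- by exists 1, 0%N; split; [case: idrP|rewrite mulr1].
- move=> x y [s [k [sP ->]]] [s' [k' [sP' ->]]]; exists (s * s'), (k + k')%N.
  by split; [apply/negP => /primP; rewrite (negPf sP) (negPf sP')|rewrite exprD; ring].
- move=> x Ix [s [k [/negP sP xE]]]; apply: sP; rewrite xE in Ix.
  by have /ideal_gen1[y ->] := gR _ _ Ix; apply: (idealMr idP).
pose c i : {pred R} := if i is i'.+1 then if i' is 0 then Q else P else pred1 0.
exists c; rewrite /c.
split=> //.
- case=> [|[|//]] _ //.
  split; first split=> //.
  + by rewrite inE eqxx.
  + by rewrite inE oner_eq0.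
  + by move=> a x y; rewrite !inE => /eqP -> /eqP ->; rewrite mulr0 addr0.
  + by move=> x y; rewrite !inE => /eqP/dom[] ->; rewrite eqxx ?orbT.
- case=> [|[|//]] _ //; split.
  + by move=> x; rewrite inE => /eqP ->; case: prQ => [[]].
  + by move/(_ f (IQ f (ideal_gen_mem (mem_head _ _)))); rewrite inE => /eqP.
  + move=> x xQ; apply: contrapT => /negP xP; apply: (QT x xQ).
    by exists x, 0%N; rewrite mulr1.
  + move/(_ g gP)=> gQ; apply: (QT g gQ); exists 1, 1%N; split; last by rewrite mul1r.
    by case: idrP.
Qed.

End Primes.

Section Bounds.
Variables (K : fieldType) (R : comNzRingType).
Variables (val : {rmorphism R -> {mpoly K[2]}}) (io : {rmorphism K -> R}).
Hypotheses (val_inj : injective val) (val_io : forall c, val (io c) = c%:MP).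

(** The ideals generated by initial segments of s form the flag. *)
Lemma regular_seq_le2 (s : seq R) : regular_seq s -> (size s <= 2)%N.
Proof.
move=> [s1 reg]; rewrite leqNgt; apply/negP => s3.
have sub i x : in_ideal_gen (take i s) x -> in_ideal_gen s x.
  apply: ideal_gen_sub; first exact: ideal_gen.
  by move=> y ys; apply/ideal_gen_mem/(mem_take ys).
apply: (ideal_flag_lt3 val_inj val_io (I := fun i => in_ideal_gen (take i s))
   (f := fun i => s`_i)).
- by move=> i _; apply: ideal_gen.
- by move/sub.
- move=> i i3; have il : (i < size s)%N by apply: leq_trans s3.
  rewrite (take_nth 0 il); split.
  + apply: ideal_gen_sub; first exact: ideal_gen.
    by move=> y ys; apply: ideal_gen_mem; rewrite mem_rcons inE ys orbT.
  + by apply: ideal_gen_mem; rewrite mem_rcons mem_head.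
  + exact: reg.
Qed.

(** With f i in c (i + 1) but not in c i, primality of c i is what lets f i cancel modulo c i. *)
Lemma prime_chain_le2 (P : {pred R}) l c : prime_chain_to P l c -> (l <= 2)%N.
Proof.
move=> [_ pr inc]; rewrite leqNgt; apply/negP => l3.
have f_ i : exists f, (i < 3)%N -> f \in c i.+1 /\ f \notin c i.
  case: (ltnP i 3) => i3; last by exists 0.
  have [_ /existsNP[f /not_implyP[fc fc']]] := inc i (leq_trans i3 l3).
  by exists f => _; split=> //; apply/negP.
have [f fP] := choice f_.
apply: (ideal_flag_lt3 val_inj val_io (I := fun i x => x \in c i) (f := f)).
- move=> i i3; apply: idealr_ideal; apply: (pr i _).1; exact: leq_trans l3.
- by have [[_ /negP]] := pr 3 l3.
- move=> i i3; have [fi fi'] := fP i i3; split=> //.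
    exact: (inc i (leq_trans i3 l3)).1.
  move=> y /((pr i (ltnW (leq_trans i3 l3))).2 _ _).
  by rewrite (negPf fi').
Qed.

Hypothesis noeth : noetherian R.

Lemma cohen_macaulay_of_regular :
  (forall P : {pred R}, is_maximal_ideal P ->
     exists f g, [/\ f \in P, g \in P & regular_seq [:: f; g]]) ->
  cohen_macaulay R.
Proof.
move=> reg; split=> // P maxP; have [f [g [fP gP rfg]]] := reg P maxP.
exists 2; split; split.
- exists [:: f; g]; split=> // x; rewrite !inE => /orP[] /eqP -> //.
- by move=> s /regular_seq_le2.
- apply: regular_height_ge2 rfg fP gP => // x y xy.
  have /eqP := congr1 val xy; rewrite rmorphM rmorph0 mulf_eq0.
  by case/orP => /eqP h; [left|right]; apply: val_inj; rewrite h rmorph0.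
- by move=> l c /prime_chain_le2.
Qed.

End Bounds.

(** * Zariski's lemma over K[u, v] *)

Lemma horner_sub_dvd (B : comNzRingType) (p : {poly B}) (e : B) :
  exists z, p.[e] = p.[0] + e * z.
Proof.
elim/poly_ind: p => [|p c _]; first by exists 0; rewrite !horner0 mulr0 addr0.
by exists p.[e]; rewrite !hornerMXaddC mulr0 add0r addrC mulrC.
Qed.

(** The determinant of q - X W is a polynomial in X with value q^n at 0, and its value at e differs
    from that by a multiple of e. *)
Lemma det_scalar_sub_dvd (B : comNzRingType) n (W : 'M[B]_n) (q e : B) :
  exists z, \det (q%:M - e *: W) = q ^+ n + e * z.
Proof.
pose N : 'M[{poly B}]_n := (q%:P)%:M - 'X *: map_mx polyC W.
have EN x : map_mx (horner_eval x) N = q%:M - x *: W.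
  by apply/matrixP => i j; rewrite !mxE /horner_eval !hornerE hornerMn hornerC.
have [z Ez] := horner_sub_dvd (\det N) e; exists z.
rewrite -EN det_map_mx [LHS]Ez; congr (_ + _).
by rewrite -[LHS]/(horner_eval 0 (\det N)) -det_map_mx EN scale0r subr0 det_scalar.
Qed.

Section DeterminantTrick.
Variables (R B : comNzRingType) (P : {pred R}) (psi : {rmorphism B -> R}).
Hypotheses (maxP : is_maximal_ideal P) (psi_inj : forall b, psi b \in P -> b = 0).
Variables (T : finType) (b : T -> R) (t0 : T) (q : B).
Hypothesis bt0 : b t0 = 1.
Hypothesis gen : forall y, exists M (c : T -> B),
  psi (q ^+ M) * y - \sum_t psi (c t) * b t \in P.

(* If R/P is a field and a finite module over psi B[1/q], then e is invertible
   in B[1/q]. *)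
Lemma dvd_power_of_finite (e : B) : e != 0 -> exists N z, q ^+ N = e * z.
Proof.
move=> e0; have idP := idealr_ideal maxP.1.
have eP : psi e \notin P by apply: contra_neqN e0 => /psi_inj.
have [w wP] := maximal_inv maxP eP.
have [M /choice[c cP]] := choice (fun t => gen (w * b t)).
pose m := (\sum_t M t)%N; pose W t s := q ^+ (m - M t) * c t s.
(* The relations for w b_t are multiplied by e, whose inverse modulo P is w, and brought to the
   common denominator q^m. *)
have WP t : psi (q ^+ m) * b t - \sum_s psi (e * W t s) * b s \in P.
  have Mt : (M t <= m)%N by rewrite /m (bigD1 t) //= leq_addr.
  have -> : psi (q ^+ m) * b t - \sum_s psi (e * W t s) * b s =
     psi e * psi (q ^+ (m - M t)) *
       (psi (q ^+ M t) * (w * b t) - \sum_s psi (c t s) * b s)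
     - psi (q ^+ m) * b t * (psi e * w - 1).
    have -> : \sum_s psi (e * W t s) * b s =
       psi e * psi (q ^+ (m - M t)) * \sum_s psi (c t s) * b s.
      by rewrite mulr_sumr; apply: eq_bigr => s _; rewrite /W !rmorphM -!mulrA.
    have -> : psi (q ^+ m) = psi (q ^+ (m - M t)) * psi (q ^+ M t).
      by rewrite -rmorphM -exprD subnK.
    move: (psi (q ^+ (m - M t))) (psi (q ^+ M t)) (\sum_s _) => x y z; ring.
  by apply: (idealB idP); apply: (idealMl idP).
pose Wm := \matrix_(i < #|T|, j < #|T|) W (enum_val i) (enum_val j).
(* N kills the vector of generators modulo P. By the adjugate, det N kills b t0 = 1 modulo P, so det
   N = 0, and expanding it modulo e shows that e divides a power of q. *)
pose N := (q ^+ m)%:M - e *: Wm.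
pose v := \col_(i < #|T|) b (enum_val i).
have Nv i : (map_mx psi N *m v) i 0 \in P.
  have := WP (enum_val i); congr (_ \in P).
  rewrite mxE (reindex (@enum_val T T)) /=; last by apply/onW_bij/enum_val_bij.
  rewrite -(eqP (_ : \sum_j psi (q ^+ m *+ (i == j)) * b (enum_val j) ==
     psi (q ^+ m) * b (enum_val i))); last first.
    rewrite (bigD1 i) //= eqxx mulr1n big1 ?addr0 // => j ji.
    by rewrite eq_sym (negPf ji) mulr0n rmorph0 mul0r.
  rewrite -sumrB; apply: eq_bigr => j _; rewrite !mxE rmorphB /=; ring.
have detP i : psi (\det N) * v i 0 \in P.
  have -> : psi (\det N) * v i 0 = (map_mx psi (\adj N) *m (map_mx psi N *m v)) i 0.
    by rewrite mulmxA -map_mxM mul_adj_mx map_scalar_mx mul_scalar_mx [RHS]mxE.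
  by rewrite mxE; apply: (ideal_sum idP) => j _; apply: (idealMl idP).
have det0 : \det N = 0.
  by apply: psi_inj; have := detP (enum_rank t0); rewrite mxE enum_rankK bt0 mulr1.
have [z Ez] := det_scalar_sub_dvd Wm (q ^+ m) e.
exists (m * #|T|)%N, (- z); rewrite exprM mulrN.
by apply/eqP; rewrite -addr_eq0 -Ez -/N det0.
Qed.

End DeterminantTrick.

Section Zariski.
Variables (K : fieldType) (R : comNzRingType) (P : {pred R}).
Variable (ev : {rmorphism {poly {poly K}} -> R}).
Variables (T : finType) (b : T -> R) (t0 : T).
Hypotheses (maxP : is_maximal_ideal P) (bt0 : b t0 = 1).
Hypothesis gen : forall y, exists a : T -> {poly {poly K}}, y = \sum_t ev (a t) * b t.

(** If K[u] embedded in R/P, then K[u, v] could not: as R/P is finite over it, u would divide 1. So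
    some g of K[u][v] dies in R/P, with leading coefficient q in K[u]. Then R/P is finite over
    K[u][1/q], and the nonconstant 1 + u q, coprime to q, would divide a power of q. *)
Lemma maximal_meets_subring : exists f : {poly K}, f != 0 /\ ev f%:P \in P.
Proof.
have idP := idealr_ideal maxP.1.
apply: contrapT => /forallNP nf.
have inj1 f : ev f%:P \in P -> f = 0.
  by move=> fP; apply/eqP/negPn/negP => f0; apply: (nf f).
have [g [g0 gP]] : exists g : {poly {poly K}}, g != 0 /\ ev g \in P.
  apply: contrapT => /forallNP ng.
  have inj2 g : ev g \in P -> g = 0.
    by move=> gP; apply/eqP/negPn/negP => g0; apply: (ng g).
  have [||N [z]] := @dvd_power_of_finite R _ P ev maxP inj2 T b t0 1 bt0 _ ('X%:P).
  - move=> y; have [a ->] := gen y; exists 0%N, a.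
    by rewrite expr0 rmorph1 mul1r subrr; apply: (ideal0 idP).
  - by rewrite polyC_eq0 polyX_eq0.
  - rewrite expr1n => /(congr1 (fun p : {poly {poly K}} => p`_0)).
    rewrite coef1 coefCM /= => /(congr1 (fun p : {poly K} => p.[0])) /eqP.
    by rewrite hornerM hornerX mul0r hornerC oner_eq0.
pose q := lead_coef g; have q0 : q != 0 by rewrite lead_coef_eq0.
pose psi := (ev \o polyC : {poly K} -> R).
pose b' (t : 'I_(size g) * T) := ev 'X ^+ t.1 * b t.2.
have sg : (0 < size g)%N by rewrite size_poly_gt0.
have evE (p : {poly {poly K}}) : (size p <= size g)%N ->
    ev p = \sum_(i < size g) psi p`_i * ev 'X ^+ i.
  move=> sp; have {1}-> : p = \sum_(i < size g) (p`_i)%:P * 'X^i.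
    rewrite -[LHS](coefK p) poly_def.
    rewrite (big_ord_widen _ (fun i => p`_i *: 'X^i) sp) big_mkcond /=.
    apply: eq_bigr => i _; rewrite mul_polyC; case: ltnP => // pi.
    by rewrite nth_default ?scale0r.
  by rewrite rmorph_sum; apply: eq_bigr => i _; rewrite rmorphM rmorphXn.
have e0 : 1 + 'X * q != 0.
  rewrite addrC -size_poly_gt0 mulrC size_polyDl size_mulX // size_poly1.
  by rewrite ltnS size_poly_gt0.
have [||N [z Ez]] :=
  @dvd_power_of_finite R _ P psi maxP inj1 _ b' (Ordinal sg, t0) q _ _ _ e0.
- by rewrite /b' expr0 mul1r.
- move=> y; have [a ->] := gen y.
  (* Pseudo-division by g: a power of q makes the division with remainder possible over K[u], and m
     serves as an exponent common to all t. *)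
  pose M t := scalp (a t) g; pose m := (\sum_t M t)%N.
  pose r t := q ^+ (m - M t) *: (a t %% g).
  have rE t : (q ^+ m)%:P * a t = q ^+ (m - M t) *: (a t %/ g) * g + r t.
    have Mt : (M t <= m)%N by rewrite /m (bigD1 t) //= leq_addr.
    rewrite mul_polyC -(subnK Mt) exprD -scalerA Pdiv.Idomain.divp_eq scalerDr.
    by rewrite -scalerAl subnK.
  have sr t : (size (r t) <= size g)%N.
    by apply: leq_trans (size_scale_leq _ _) _; rewrite ltnW // ltn_modp.
  pose cf (t : 'I_(size g) * T) : {poly K} := (r t.2)`_(t.1 : 'I__).
  exists m, cf.
  have -> : psi (q ^+ m) * (\sum_t ev (a t) * b t) -
     \sum_t psi (cf t) * b' t =
     \sum_t ev (q ^+ (m - M t) *: (a t %/ g)) * b t * ev g.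
    rewrite -(pair_bigA _ (fun i t => psi (cf (i, t)) * b' (i, t))) exchange_big /=.
    rewrite mulr_sumr -sumrB; apply: eq_bigr => t _.
    rewrite mulrA -[psi (q ^+ m)]/(ev (q ^+ m)%:P) -rmorphM rE rmorphD rmorphM.
    rewrite (evE (r t)) // mulrDl [X in _ + X - _]mulr_suml.
    rewrite [X in _ + X - _](eq_bigr (fun i => psi (cf (i, t)) * b' (i, t))).
      by rewrite addrK mulrAC.
    by move=> i _; rewrite /b' /cf /= mulrA.
  by apply: (ideal_sum idP) => t _; apply: (idealMl idP).
have cop : coprimep (1 + 'X * q) q.
  by apply/Bezout_eq1_coprimepP; exists (1, - 'X); rewrite /= mul1r mulNr addrK.
have : 1 + 'X * q %| q ^+ N * 1 by rewrite mulr1 Ez dvdp_mulr.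
rewrite Gauss_dvdpr; last by apply: coprimep_expr.
rewrite dvdp1 addrC mulrC size_polyDl size_mulX // ?size_poly1 ?ltnS ?size_poly_gt0 //.
by rewrite eqSS size_poly_eq0 (negPf q0).
Qed.

End Zariski.

(** * Semigroup rings in the plane *)

Section Dickson.
Local Open Scope nat_scope.

Lemma dickson1 (W : nat -> Prop) :
  exists L : seq nat, (forall x, x \in L -> W x) /\
    forall a, W a -> exists2 x, x \in L & x <= a.
Proof.
have [[a Wa]|nW] := pselect (exists a, W a); last first.
  by exists [::]; split=> // a Wa; case: nW; exists a.
have exW : exists a, `[< W a >] by exists a; apply/asboolP.
case: (ex_minnP exW) => x /asboolP Wx xmin; exists [:: x]; split.
  by move=> y; rewrite inE => /eqP ->.
by move=> b Wb; exists x; [rewrite mem_head|apply/xmin/asboolP].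
Qed.

(** Given one point (a0, b0) of W, any other lies above it or on one of the finitely many columns a
    < a0 or rows b < b0, each of which has a least point. *)
Lemma dickson2 (W : nat -> nat -> Prop) :
  exists L : seq (nat * nat), (forall x, x \in L -> W x.1 x.2) /\
    forall a b, W a b -> exists2 x, x \in L & x.1 <= a /\ x.2 <= b.
Proof.
have [[a0 [b0 W0]]|nW] := pselect (exists a b, W a b); last first.
  by exists [::]; split=> // a b Wab; case: nW; exists a, b.
have [col colP] := choice (fun a => dickson1 (W a)).
have [row rowP] := choice (fun b => dickson1 (W^~ b)).
exists ((a0, b0) :: [seq (a, y) | a <- iota 0 a0, y <- col a] ++
                   [seq (x, b) | b <- iota 0 b0, x <- row b]); split.
  move=> x; rewrite inE mem_cat => /orP[/eqP -> //|/orP[]].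
    by case/allpairsPdep => a [y [_ yc ->]]; apply: (colP a).1.
  by case/allpairsPdep => b [y [_ yc ->]]; apply: (rowP b).1.
move=> a b Wab; have [aa0|aa0] := ltnP a a0.
  have [y yc yb] := (colP a).2 b Wab; exists (a, y) => //.
  by rewrite inE mem_cat allpairs_f_dep ?mem_iota ?orbT.
have [bb0|bb0] := ltnP b b0.
  have [x xr xa] := (rowP b).2 a Wab; exists (x, b) => //.
  rewrite inE mem_cat.
  rewrite (_ : (x, b) \in [seq (x, b) | b <- iota 0 b0, x <- row b]) ?orbT //.
  by apply/allpairsPdep; exists b, x; rewrite mem_iota.
by exists (a0, b0); rewrite ?mem_head.
Qed.

(** Within one pair of residues modulo m, the order of N^2 becomes translation by (m, 0) and (0, m).
    This serves leading exponents of an ideal as well as S itself. *)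
Lemma dickson_mnm (m : nat) (Q : 'X_{1..2} -> Prop) : 0 < m ->
  exists L : seq 'X_{1..2}, (forall l, l \in L -> Q l) /\
    forall s, Q s -> exists2 l, l \in L &
      exists i j, s = (l + mnm2 m 0 *+ i + mnm2 0 m *+ j)%MM.
Proof.
move=> m0.
pose p (c : 'I_m * 'I_m) (x : nat * nat) := mnm2 (x.1 * m + c.1) (x.2 * m + c.2).
have [L LP] := choice (fun c => dickson2 (fun a b => Q (p c (a, b)))).
exists [seq p c x | c <- enum {: 'I_m * 'I_m}, x <- L c]; split.
  by move=> l /allpairsPdep[c [x [_ xL ->]]]; have := (LP c).1 x xL; case: x {xL}.
move=> s Qs.
pose c := (Ordinal (ltn_pmod (s ord0) m0), Ordinal (ltn_pmod (s ord_max) m0)).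
have sE : s = p c (s ord0 %/ m, s ord_max %/ m).
  by apply: mnm2P; rewrite !mnm2E /= -divn_eq.
rewrite sE in Qs; have [[x y] xL [/= xa yb]] := (LP c).2 _ _ Qs.
exists (p c (x, y)); first by rewrite allpairs_f_dep // mem_enum.
exists (s ord0 %/ m - x), (s ord_max %/ m - y).
rewrite {1}sE; apply: mnm2P; rewrite !mnm2E /=.
  by rewrite mul0n addn0 addnAC [m * _]mulnC -mulnDl subnKC.
by rewrite mul0n addn0 addnAC [m * _]mulnC -mulnDl subnKC.
Qed.

End Dickson.

Lemma modp_sum (K : fieldType) (c : {poly K}) (T : Type) (s : seq T)
    (F : T -> {poly K}) :
  (\sum_(t <- s) F t) %% c = \sum_(t <- s) (F t %% c).
Proof. by apply: (big_morph (fun p => p %% c)); [apply: modpD|apply: mod0p]. Qed.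

(* Nonzero polynomials in distinct variables are coprime. *)
Lemma dvd_of_mul_polyC (K : fieldType) (g c : {poly K}) (y z : {poly {poly K}}) :
    g != 0 -> map_poly polyC g * y = c%:P * z ->
  exists y1, y = c%:P * y1.
Proof.
move=> g0 E; pose r := \poly_(j < size y) (y`_j %% c).
have rE j : r`_j = y`_j %% c.
  by rewrite coef_poly; case: ltnP => // yj; rewrite nth_default // mod0p.
have r0 : r = 0.
  have : map_poly polyC g * r == 0.
    apply/eqP/polyP => k; rewrite coef0 coefM.
    transitivity ((c%:P * z)`_k %% c); last by rewrite coefCM mulrC modp_mull.
    rewrite -E coefM modp_sum; apply: eq_bigr => i _.
    by rewrite rE coef_map /= !mul_polyC modpZl.
  rewrite mulf_eq0 map_poly_eq0_id0 ?lead_coef_eq0 ?polyC_eq0 ?lead_coef_eq0 //.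
  by rewrite (negPf g0) => /eqP.
exists (\poly_(j < size y) (y`_j %/ c)); apply/polyP => j.
rewrite coefCM coef_poly; case: ltnP => yj; last by rewrite nth_default ?mulr0.
by rewrite {1}(divp_eq y`_j c) -rE r0 coef0 addr0 mulrC.
Qed.

(** * Polynomials in one monomial, and K[x, y] as K[x][y] *)

Section Substitution.
Variables (K : fieldType).

Definition poly_at (n : nat) (a : 'X_{1..n}) (f : {poly K}) : {mpoly K[n]} :=
  \sum_(i < size f) f`_i *: 'X_[a *+ i].

(** This turns membership of f(t^a) h in K[S] into information on each exponent of h. *)
Lemma msupp_poly_at_mul (a : 'X_{1..2}) (f : {poly K}) (h : {mpoly K[2]}) s :
    a != 0%MM -> f != 0 -> s \in msupp h ->
  exists i, (s + a *+ i)%MM \in msupp (poly_at a f * h).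
Proof.
move=> a0 f0 sh.
have a1 : (0 < mdeg a)%N by rewrite lt0n mdeg_eq0.
have exk : exists k, (s + a *+ k)%MM \in msupp h by exists 0%N; rewrite mulm0n addm0.
have bnd k : (s + a *+ k)%MM \in msupp h -> (k <= msize h)%N.
  move=> /msize_mdeg_lt; rewrite mdegD mdegMn => kh.
  have : (k <= mdeg a * k)%N by rewrite leq_pmull.
  by lia.
case: (ex_maxnP exk bnd) => k kh kmax.
(* For the last k with s + k a in the support of h, only the leading term of f
   contributes to the coefficient at s + (k + deg f) a. *)
exists (k + (size f).-1)%N; rewrite mcoeff_msupp /poly_at mulr_suml raddf_sum /=.
have f1 : (0 < size f)%N by rewrite size_poly_gt0.
have E (i : 'I_(size f)) : (f`_i *: 'X_[a *+ i] * h)@_(s + a *+ (k + (size f).-1)) =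
   f`_i * h@_(s + a *+ (k + (size f).-1 - i)).
  have ile : (i <= k + (size f).-1)%N by have := ltn_ord i; lia.
  have -> : (s + a *+ (k + (size f).-1) = a *+ i + (s + a *+ (k + (size f).-1 - i)))%MM.
    by apply/mnmP => j; rewrite !(mnmDE, mulmnE) -{1}(subnKC ile) mulnDr addnCA.
  by rewrite -scalerAl mcoeffZ ['X_[_] * _]mulrC mcoeffMX.
have lt1 : ((size f).-1 < size f)%N by rewrite prednK.
rewrite (bigD1 (Ordinal lt1) isT) big1 ?addr0.
  by rewrite E /= addnK ?addr0 mulf_neq0 // -?mcoeff_msupp // -lead_coefE lead_coef_eq0.
move=> i; rewrite -val_eqE /= => i1; rewrite E memN_msupp_eq0 ?mulr0 //.
apply/negP => /kmax le; have lt := ltn_ord i; move/eqP: i1 => i1.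
by move: f1 le lt i1; set N := size f; set x := nat_of_ord i; lia.
Qed.

(** The inner variable is x and the outer one y, so polynomials in x alone become constants and
    setting y = 0 becomes evaluation at 0. *)
Definition to_poly2 : {rmorphism {mpoly K[2]} -> {poly {poly K}}} :=
  mmap (polyC \o polyC) (fun i => if i == ord0 then 'X%:P else 'X).

Definition of_poly2 : {rmorphism {poly {poly K}} -> {mpoly K[2]}} :=
  horner_morph (fun p => mulrC 'X_ord_max
    (horner_morph (fun c => mulrC ('X_ord0 : {mpoly K[2]}) (mpolyC 2 c)) p)).

Lemma to_poly2C c : to_poly2 c%:MP = c%:P%:P.
Proof. by rewrite /to_poly2 /= mmapC. Qed.

Lemma to_poly2X (s : 'X_{1..2}) : to_poly2 'X_[s] = ('X ^+ s ord0)%:P * 'X ^+ s ord_max.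
Proof.
rewrite /to_poly2 /= mmapX /mmap1 big_ord_recl big_ord1 rmorphXn /=.
by congr (_ * 'X ^+ s _); apply: val_inj.
Qed.

Lemma to_poly2Z c p : to_poly2 (c *: p) = c%:P%:P * to_poly2 p.
Proof. by rewrite -mul_mpolyC rmorphM /= to_poly2C. Qed.

Lemma to_poly2K : cancel to_poly2 of_poly2.
Proof.
apply: mpolyind => [|c s p _ _ IH]; first by rewrite !rmorph0.
rewrite !rmorphD /= IH to_poly2Z to_poly2X !rmorphM !rmorphXn /=.
rewrite /of_poly2 /= !horner_morphC /= horner_morphX !horner_morphC horner_morphX /=.
rewrite (mpolyXE_id K s) big_ord_recl big_ord1 mul_mpolyC.
by congr (_ *: (_ * 'X_ _ ^+ s _) + _); apply: val_inj.
Qed.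

Lemma coef00_to_poly2 p : (to_poly2 p).[0].[0] = p@_0.
Proof.
elim/mpolyind: p => [|c s p _ _ IH]; first by rewrite rmorph0 !horner0 mcoeff0.
rewrite rmorphD /= !hornerD IH mcoeffD; congr (_ + _).
rewrite to_poly2Z to_poly2X !(hornerM, hornerXn, hornerC).
rewrite mcoeffZ mcoeffX; congr (_ * _).
have [->|s0] := eqVneq s 0%MM; first by rewrite !mnm0E !expr0 hornerC mulr1.
have [s1|s1] := posnP (s ord_max); last by rewrite !expr0n (gtn_eqF s1) horner0 mulr0.
have [s2|s2] := posnP (s ord0); last by rewrite expr0n (gtn_eqF s2) mul0r.
by case/eqP: s0; apply: mnm2P; rewrite mnm0E.
Qed.

End Substitution.

(** * The ring K[S] for S in N^2: noetherianity, finiteness over K[u, v], regular sequences *)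

Section PlaneSemigroupRing.
Variables (K : fieldType) (A : seq 'X_{1..2}).
Local Notation R := (semigroup_ring K A).
Local Notation S := (submonoid_gen A).

Definition sgval (f : R) : {mpoly K[2]} := val f.

HB.instance Definition _ := GRing.RMorphism.copy sgval (val : R -> {mpoly K[2]}).

Lemma sgval_inj : injective sgval. Proof. exact: val_inj. Qed.

Lemma sgvalD f g : sgval (f + g) = sgval f + sgval g. Proof. exact: rmorphD. Qed.
Lemma sgvalM f g : sgval (f * g) = sgval f * sgval g. Proof. exact: rmorphM. Qed.
Lemma sgvalB f g : sgval (f - g) = sgval f - sgval g. Proof. exact: rmorphB. Qed.

Lemma sgvalP (f : R) s : s \in msupp (sgval f) -> s \in S.
Proof. by move=> sf; have /allP := valP f; apply. Qed.

Lemma semigroup_suppP (f : {mpoly K[2]}) :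
  (forall s, s \in msupp f -> s \in S) -> f \in semigroup_supp A.
Proof. by move=> fS; apply/allP. Qed.

(** Made total by sending polynomials outside K[S] to 0. *)
Definition sg (f : {mpoly K[2]}) : R := insubd 0 f.

Lemma sgK f : f \in semigroup_supp A -> sgval (sg f) = f.
Proof. exact: insubdK. Qed.

Lemma semigroup_suppX s : s \in S -> ('X_[s] : {mpoly K[2]}) \in semigroup_supp A.
Proof. by move=> sS; apply: semigroup_suppP => t; rewrite msuppX inE => /eqP ->. Qed.

Lemma semigroup_suppC c : (c%:MP : {mpoly K[2]}) \in semigroup_supp A.
Proof.
apply: semigroup_suppP => t; rewrite msuppC; case: ifP => // _.
by rewrite inE => /eqP ->; apply: submonoid_gen0.
Qed.

Lemma sgX s : s \in S -> sgval (sg 'X_[s]) = 'X_[s].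
Proof. by move=> sS; rewrite sgK // semigroup_suppX. Qed.

Definition sgC (c : K) : R := sg c%:MP.

Lemma sgCE c : sgval (sgC c) = c%:MP.
Proof. by rewrite sgK // semigroup_suppC. Qed.

Lemma sgC_zmod_morphism : zmod_morphism sgC.
Proof. by move=> c e; apply: sgval_inj; rewrite rmorphB /= !sgCE mpolyCB. Qed.

Lemma sgC_monoid_morphism : monoid_morphism sgC.
Proof.
by split=> [|c e]; apply: sgval_inj; rewrite ?rmorphM ?rmorph1 /= !sgCE ?mpolyCM.
Qed.

HB.instance Definition _ := GRing.isZmodMorphism.Build K R sgC sgC_zmod_morphism.
HB.instance Definition _ := GRing.isMonoidMorphism.Build K R sgC sgC_monoid_morphism.

Lemma sg_integral (x y : R) : x * y = 0 -> x = 0 \/ y = 0.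
Proof.
move=> xy; have /eqP := congr1 sgval xy; rewrite rmorphM rmorph0 mulf_eq0.
by case/orP => /eqP h; [left|right]; apply: sgval_inj; rewrite h rmorph0.
Qed.

Lemma mpolyX_neq0 (s : 'X_{1..2}) : 'X_[s] != 0 :> {mpoly K[2]}.
Proof. by rewrite -msupp_eq0 msuppX. Qed.

Section Noether.
Variable m : nat.
Hypotheses (m_gt0 : (0 < m)%N) (uS : mnm2 m 0 \in S) (vS : mnm2 0 m \in S).

(** A Gröbner basis argument: finitely many elements of I have leading exponents from which all
    others arise by adding multiples of (m, 0) and (0, m), that is, by multiplying with u^i v^j in
    K[S]. Cancelling leading terms then terminates. *)
Lemma sg_noetherian : noetherian R.
Proof.
move=> I idrI; have idI := idealr_ideal idrI.
pose Q s := exists f : R, [/\ f \in I, f != 0 & mlead (sgval f) = s].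
have [L [LQ LP]] := dickson_mnm Q m_gt0.
have /choice[F FP] : forall l, exists f : R, l \in L ->
    [/\ f \in I, f != 0 & mlead (sgval f) = l].
  by move=> l; case: (boolP (l \in L)) => [/LQ[f fP]|_]; [exists f|exists 0].
exists (map F L) => f; split; last first.
  by apply: (ideal_gen_sub idI) => x /mapP[l /FP[? _ _] ->].
have [p pE] : exists p, p = sgval f by exists (sgval f).
elim/mleadrect: p f pE => p IH f pE fI.
have [->|f0] := eqVneq f 0; first exact: (ideal0 (ideal_gen _)).
have [l lL [i [j E]]] := LP (mlead p) (ex_intro _ f (And3 fI f0 (esym (congr1 _ pE)))).
have [lI l0 lE] := FP l lL.
have tS : (mnm2 m 0 *+ i + mnm2 0 m *+ j)%MM \in S.
  by apply: submonoid_genD; apply: submonoid_gen_mulmn.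
set t := (_ + _)%MM in tS.
have {}E : mlead p = (t + l)%MM by rewrite E -addmA addmC.
have nz (g : R) : g != 0 -> mleadc (sgval g) != 0.
  move=> g0; rewrite mleadc_eq0; apply: contra_neq g0 => g0.
  by apply: sgval_inj; rewrite g0 rmorph0.
have [c cE] : exists c, c = mleadc (sgval f) / mleadc (sgval (F l)) by eexists.
pose h := sgC c * sg 'X_[t] * F l.
have hE : sgval h = c *: ('X_[t] * sgval (F l)).
  by rewrite !rmorphM /= sgCE sgX // mul_mpolyC scalerAl.
have hgen : in_ideal_gen (map F L) h.
  by apply: (idealMl (ideal_gen _)); apply: ideal_gen_mem; apply: map_f.
have c0 : c != 0 by rewrite cE mulf_neq0 ?invr_eq0 ?nz.
have F0 : sgval (F l) != 0 by rewrite -mleadc_eq0 nz.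
have hlead : mlead (sgval h) = mlead p.
  by rewrite hE mleadZ // (mleadM (mpolyX_neq0 t) F0) mleadXm lE E.
have hcoef : (sgval h)@_(mlead p) = (sgval f)@_(mlead p).
  have Fl : (sgval (F l))@_l = mleadc (sgval (F l)) by rewrite lE.
  rewrite hE mcoeffZ E ['X_[_] * _]mulrC mcoeffMX cE Fl.
  by rewrite divfK ?nz // -E pE.
rewrite -[f](subrK h); apply: (idealD (ideal_gen _)) => //.
have [->|d0] := eqVneq (f - h) 0; first exact: (ideal0 (ideal_gen _)).
apply: (IH (sgval (f - h))) => //; last first.
  by apply: (idealB idI) => //; apply: (idealMl idI).
have d0' : sgval (f - h) != 0 by rewrite -mleadc_eq0 nz.
have dE : sgval (f - h) = p - sgval h by rewrite pE rmorphB.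
rewrite lt_neqAle; apply/andP; split.
  apply/eqP => e; have := mlead_supp d0'; rewrite e mcoeff_msupp dE.
  by rewrite mcoeffB hcoef pE subrr eqxx.
by rewrite dE (le_trans (mleadB_le _ _)) // hlead joinxx.
Qed.

(** The inner variable goes to u and the outer one to v. *)
Definition sg_eval (u v : R) : {rmorphism {poly {poly K}} -> R} :=
  horner_morph (fun p => mulrC v (horner_morph (fun c => mulrC u (sgC c)) p)).

Lemma sg_evalX u v : sg_eval u v 'X = v.
Proof. by rewrite /sg_eval /= horner_morphX. Qed.

Lemma sg_evalXC u v : sg_eval u v 'X%:P = u.
Proof. by rewrite /sg_eval /= horner_morphC /= horner_morphX. Qed.

Lemma sg_evalCC u v c : sg_eval u v c%:P%:P = sgC c.
Proof. by rewrite /sg_eval /= horner_morphC /= horner_morphC. Qed.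

Lemma sg_evalC s v f : s \in S ->
  sgval (sg_eval (sg 'X_[s]) v f%:P) = poly_at s f.
Proof.
move=> sS; have {1}-> : f%:P = \sum_(i < size f) (f`_i)%:P%:P * 'X%:P ^+ i.
  rewrite -{1}[f]coefK poly_def rmorph_sum; apply: eq_bigr => i _.
  by rewrite -mul_polyC rmorphM rmorphXn.
rewrite !rmorph_sum; apply: eq_bigr => i _.
by rewrite !rmorphM !rmorphXn /= sg_evalCC sg_evalXC sgCE sgX // mul_mpolyC mpolyXn.
Qed.

(** S is covered by finitely many translates of the monoid generated by (m, 0) and (0, m); the
    exponent 0 is prepended to have 1 among the generators. Both orders of u and v are allowed, so
    that a polynomial in either variable can be found in a maximal ideal. *)
Lemma sg_finite (u v : R) : (u = sg 'X_[mnm2 m 0] /\ v = sg 'X_[mnm2 0 m]) \/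
    (u = sg 'X_[mnm2 0 m] /\ v = sg 'X_[mnm2 m 0]) ->
  exists (T : finType) (b : T -> R) (t0 : T), b t0 = 1 /\
    forall y, exists a : T -> {poly {poly K}}, y = \sum_t sg_eval u v (a t) * b t.
Proof.
move=> uv; have [L [LS LP]] := dickson_mnm (fun s => s \in S) m_gt0.
pose l (i : 'I_(size L).+1) := nth 0%MM (0%MM :: L) i.
have lS i : l i \in S.
  rewrite /l; case: i => [[|i] /= il]; first exact: submonoid_gen0.
  by apply: LS; rewrite mem_nth.
exists 'I_(size L).+1, (fun i => sg 'X_[l i]), ord0; split.
  by apply: sgval_inj; rewrite sgX // rmorph1 mpolyX0.
pose ok (f : {mpoly K[2]}) := exists a : 'I_(size L).+1 -> {poly {poly K}},
  f = \sum_i sgval (sg_eval u v (a i) * sg 'X_[l i]).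
have okD f g : ok f -> ok g -> ok (f + g).
  move=> [a ->] [b ->]; exists (fun i => a i + b i).
  rewrite -big_split /=; apply: eq_bigr => i _.
  by rewrite (rmorphD (sg_eval u v)) mulrDl [RHS]rmorphD.
have ok0 : ok 0.
  by exists (fun=> 0); rewrite big1 // => i _; rewrite rmorph0 mul0r rmorph0.
have okX c s : s \in S -> ok (c *: 'X_[s]).
  move=> /LP[s' s'L [i [j ->]]].
  have [w wE] : exists w, sg_eval u v w = sg 'X_[mnm2 m 0] ^+ i * sg 'X_[mnm2 0 m] ^+ j.
    case: uv => -[-> ->].
      by exists ('X%:P ^+ i * 'X ^+ j); rewrite rmorphM !rmorphXn /= sg_evalX sg_evalXC.
    by exists ('X ^+ i * 'X%:P ^+ j); rewrite rmorphM !rmorphXn /= sg_evalX sg_evalXC.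
  have kP : ((index s' L).+1 < (size L).+1)%N by rewrite ltnS index_mem.
  pose k := Ordinal kP; have lk : l k = s' by rewrite /l /= nth_index.
  exists (fun t => if t == k then c%:P%:P * w else 0).
  rewrite (bigD1 k) //= eqxx big1 ?addr0; last first.
    by move=> t /negPf ->; rewrite rmorph0 mul0r rmorph0.
  rewrite !rmorphM /= sg_evalCC wE lk sgCE rmorphM !rmorphXn /=.
  rewrite !sgX //; last exact: LS.
  rewrite !mpolyXn -!mpolyXD mul_mpolyC -scalerAl -mpolyXD.
  by congr (_ *: 'X_[_]); rewrite -addmA addmC.
move=> y; have [a aE] : ok (sgval y).
  rewrite [sgval y]mpolyE big_seq_cond; apply: big_ind => // s /andP[sy _].
  by apply: okX; apply: sgvalP sy.
by exists a; apply: sgval_inj; rewrite aE rmorph_sum.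
Qed.

Lemma maximal_contains_poly_at (P : {pred R}) s : s = mnm2 m 0 \/ s = mnm2 0 m ->
  is_maximal_ideal P ->
  exists f : {poly K}, f != 0 /\ exists2 F : R, F \in P & sgval F = poly_at s f.
Proof.
move=> hs maxP.
have sS : s \in S by case: hs => ->.
have [v uv] : exists v : R, (sg 'X_[s] = sg 'X_[mnm2 m 0] /\ v = sg 'X_[mnm2 0 m]) \/
    (sg 'X_[s] = sg 'X_[mnm2 0 m] /\ v = sg 'X_[mnm2 m 0]) :> Prop.
  by case: hs => ->; [exists (sg 'X_[mnm2 0 m]); left|exists (sg 'X_[mnm2 m 0]); right].
have [T [b [t0 [bt0 gen]]]] := sg_finite uv.
have [f [f0 fP]] := maximal_meets_subring maxP bt0 gen.
by exists f; split=> //; exists (sg_eval (sg 'X_[s]) v f%:P) => //; apply: sg_evalC.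
Qed.

Lemma to_poly2_poly_at_x (f : {poly K}) :
  exists c : {poly K}, to_poly2 K (poly_at (mnm2 m 0) f) = c%:P.
Proof.
exists (\sum_(i < size f) (f`_i)%:P * 'X ^+ (m * i)).
rewrite /poly_at !rmorph_sum; apply: eq_bigr => i _ /=.
by rewrite to_poly2Z to_poly2X !mnm2E mul0n expr0 mulr1 rmorphM.
Qed.

Lemma to_poly2_poly_at_y (f : {poly K}) :
  exists c : {poly K}, to_poly2 K (poly_at (mnm2 0 m) f) = map_poly polyC c.
Proof.
exists (\sum_(i < size f) f`_i *: 'X ^+ (m * i)).
rewrite /poly_at !rmorph_sum; apply: eq_bigr => i _ /=.
by rewrite to_poly2Z to_poly2X !mnm2E mul0n expr0 mul1r linearZ /= map_polyXn mul_polyC.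
Qed.

Lemma poly_at_neq0 (a : 'X_{1..2}) (f : {poly K}) :
  a != 0%MM -> f != 0 -> poly_at a f != 0.
Proof.
move=> a0 f0; have := @msupp_poly_at_mul K a f 1 0%MM a0 f0.
rewrite msupp1 inE eqxx mulr1 => /(_ isT)[i]; apply: contraTneq => ->.
by rewrite msupp0.
Qed.

Hypothesis crit : forall (s : 'X_{1..2}) i j, (s + mnm2 m 0 *+ i)%MM \in S ->
  (s + mnm2 0 m *+ j)%MM \in S -> s \in S.

(** If G y = F z, coprimality in K[x, y] gives y = F y' and z = G y'. As y and z lie in K[S], each
    exponent of y' enters S along both axes, hence lies in S by [crit]. *)
Lemma poly_at_regular (P : {pred R}) (f g : {poly K}) (F G : R) :
    idealr_closed P -> F \in P -> G \in P -> f != 0 -> g != 0 ->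
    sgval F = poly_at (mnm2 m 0) f -> sgval G = poly_at (mnm2 0 m) g ->
  regular_seq [:: F; G].
Proof.
move=> idrP FP GP f0 g0 FE GE; have idP := idealr_ideal idrP.
have u0 : mnm2 m 0 != 0%MM.
  by apply/eqP => /(congr1 (fun s : 'X_{1..2} => s ord0)); rewrite !mnm2E; lia.
have v0 : mnm2 0 m != 0%MM.
  by apply/eqP => /(congr1 (fun s : 'X_{1..2} => s ord_max)); rewrite !mnm2E; lia.
have F0 := poly_at_neq0 u0 f0; have G0 := poly_at_neq0 v0 g0.
split.
  have [_ /negP P1 _] := idrP; move=> /(ideal_gen_sub idP) h; apply: P1; apply: h.
  by move=> x; rewrite !inE => /orP[] /eqP ->.
case=> [|[|//]] _ y /=; rewrite ?ideal_gen_nil.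
  case/sg_integral => // F00; case/eqP: F0.
  by rewrite -FE F00 rmorph0.
rewrite !ideal_gen1 => -[z Gy].
have [c cE] := to_poly2_poly_at_x f; have [e eE] := to_poly2_poly_at_y g.
have Gy' : poly_at (mnm2 0 m) g * sgval y = poly_at (mnm2 m 0) f * sgval z.
  by rewrite -FE -GE -!rmorphM Gy.
have e0 : e != 0.
  apply: contra_neq G0 => e0; apply: (can_inj (@to_poly2K K)).
  by rewrite eE e0 !rmorph0.
have := congr1 (to_poly2 K) Gy'; rewrite !rmorphM /= cE eE.
move=> /(dvd_of_mul_polyC e0)[y1 /(congr1 (of_poly2 K))].
rewrite rmorphM /= -cE !to_poly2K; set y' := of_poly2 K y1 => yE.
have zE : sgval z = poly_at (mnm2 0 m) g * y'.
  by apply: (mulfI F0); rewrite -Gy' yE mulrCA.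
have y'S : y' \in semigroup_supp A.
  apply: semigroup_suppP => s sy.
  have [i si] := msupp_poly_at_mul u0 f0 sy; have [j sj] := msupp_poly_at_mul v0 g0 sy.
  by apply: (@crit s i j); [apply: (@sgvalP y)|apply: (@sgvalP z)]; rewrite ?yE ?zE.
by exists (sg y'); apply: sgval_inj; rewrite rmorphM /= sgK // FE.
Qed.

Theorem sg_cohen_macaulay : cohen_macaulay R.
Proof.
apply: (cohen_macaulay_of_regular sgval_inj sgCE sg_noetherian) => P maxP.
have [f [f0 [F FP FE]]] := maximal_contains_poly_at (or_introl erefl) maxP.
have [g [g0 [G GP GE]]] := maximal_contains_poly_at (or_intror erefl) maxP.
by exists F, G; split=> //; apply: (poly_at_regular maxP.1 FP GP f0 g0 FE GE).
Qed.

End Noether.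

(** * The maximal ideal at the origin and the failure of the Cohen-Macaulay property *)

Definition origin_ideal : {pred R} := fun f => (sgval f)@_0 == 0.

Lemma origin_maximal : is_maximal_ideal origin_ideal.
Proof.
have mul0 (f g : {mpoly K[2]}) : (f * g)@_0 = f@_0 * g@_0.
  exact: (mcoeff0_is_multiplicative 2 K).1.
split.
  split; rewrite ?unfold_in ?rmorph0 ?rmorph1 ?mcoeff0 ?mcoeff1 ?eqxx ?oner_eq0 //.
  move=> a f g; rewrite !unfold_in => /eqP f0 /eqP g0.
  by rewrite sgvalD sgvalM mcoeffD mul0 f0 g0 mulr0 addr0.
move=> I idrI mI x xI; have idI := idealr_ideal idrI.
rewrite unfold_in; apply: contraT => c0; set c := _@_0 in c0.
have cI : sgC c \in I.
  rewrite -[sgC c](subKr x); apply: (idealB idI) => //; apply: mI.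
  by rewrite unfold_in sgvalB sgCE mcoeffB mcoeffC eqxx mulr1 subrr.
have [_ /negP I1 _] := idrI; case: I1.
by rewrite -(rmorph1 sgC) -(mulVf c0) rmorphM; apply: (idealMl idI).
Qed.

(** The middle prime Q consists of the elements vanishing on the line y = 0: it contains v but not
    u. *)
Lemma origin_height_ge2 m : (0 < m)%N -> mnm2 m 0 \in S -> mnm2 0 m \in S ->
  exists c, prime_chain_to origin_ideal 2 c.
Proof.
move=> m0 uS vS.
pose Q : {pred R} := fun f => (to_poly2 K (sgval f)).[0] == 0.
have qD f g : (to_poly2 K (sgval (f + g))).[0] =
    (to_poly2 K (sgval f)).[0] + (to_poly2 K (sgval g)).[0].
  by rewrite sgvalD rmorphD hornerD.
have qM f g : (to_poly2 K (sgval (f * g))).[0] =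
    (to_poly2 K (sgval f)).[0] * (to_poly2 K (sgval g)).[0].
  by rewrite sgvalM rmorphM hornerM.
have ux : (to_poly2 K (sgval (sg 'X_[mnm2 m 0]))).[0] = 'X ^+ m.
  by rewrite sgX // to_poly2X !mnm2E expr0 mulr1 hornerC.
have vx : (to_poly2 K (sgval (sg 'X_[mnm2 0 m]))).[0] = 0.
  by rewrite sgX // to_poly2X !mnm2E hornerM hornerXn expr0n gtn_eqF // mulr0.
pose c i : {pred R} :=
  if i is i'.+1 then if i' is 0 then Q else origin_ideal else pred1 0.
exists c; rewrite /c; split=> //.
- case=> [|[|i]] _ /=; last by apply: maximal_prime; apply: origin_maximal.
  split; first split.
  + by rewrite inE eqxx.
  + by rewrite inE oner_eq0.
  + by move=> a x y; rewrite !inE => /eqP -> /eqP ->; rewrite mulr0 addr0.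
  + by move=> x y; rewrite !inE => /eqP/sg_integral[] ->; rewrite eqxx ?orbT.
  split; first split; rewrite ?unfold_in ?rmorph0 ?rmorph1 ?hornerC ?oner_eq0 //.
  + by move=> a x y; rewrite !unfold_in qD qM => /eqP -> /eqP ->; rewrite mulr0 addr0.
  + by move=> x y; rewrite !unfold_in qM mulf_eq0.
- case=> [|[|//]] _; split.
  + by move=> x; rewrite inE => /eqP ->; rewrite unfold_in !rmorph0 horner0.
  + move=> /(_ (sg 'X_[mnm2 0 m])); rewrite unfold_in vx inE => /(_ (eqxx _)) /eqP.
    move/(congr1 sgval)/eqP; rewrite sgX // rmorph0; exact/negP/mpolyX_neq0.
  + by move=> x; rewrite !unfold_in -coef00_to_poly2 => /eqP ->; rewrite horner0.
  + move=> /(_ (sg 'X_[mnm2 m 0])); rewrite !unfold_in -coef00_to_poly2 ux.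
    rewrite hornerXn expr0n gtn_eqF // => /(_ (eqxx _)); rewrite expf_eq0 polyX_eq0.
    by rewrite andbF.
Qed.

Lemma submonoid_gen_split s : uniq A -> s \in S -> s != 0%MM ->
  exists a t, [/\ a \in A, t \in S & s = (a + t)%MM].
Proof.
move=> uA sS s0.
have [] : s \in S /\ (s = 0%MM \/ exists a t, [/\ a \in A, t \in S & s = (a + t)%MM]);
  last by move=> _ [E|//]; rewrite E eqxx in s0.
elim/submonoid_gen_ind: s / sS {s0} => [|s t [sS hs] [tS ht]|a aA].
- by split; [apply: submonoid_gen0|left].
- split; first exact: submonoid_genD.
  case: hs => [->|[a [s' [aA s'S ->]]]]; first by rewrite add0m.
  by right; exists a, (s' + t)%MM; rewrite -addmA; split=> //; apply: submonoid_genD.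
- split; first exact: submonoid_gen_mem.
  by right; exists a, 0%MM; rewrite addm0; split=> //; apply: submonoid_gen0.
Qed.

Theorem sg_not_cohen_macaulay m h : (0 < m)%N -> mnm2 m 0 \in S -> mnm2 0 m \in S ->
    uniq A -> h \notin S -> (forall a, a \in A -> (h + a)%MM \in S) ->
  ~ cohen_macaulay R.
Proof.
move=> m0 uS vS uA hS hA [_ /(_ _ origin_maximal)[k [[[s [[_ reg] sP sk]] _] [_ hk]]]].
have [c ch] := origin_height_ge2 m0 uS vS; have := hk 2 c ch.
rewrite -sk; case: s reg sP {sk} => [|f [|g s]] // reg sP _.
(* Without constant term, every exponent of x starts with a generator a, and h + a lies in S; so x
   t^h stays in K[S]. *)
have shift (x : R) : x \in origin_ideal -> exists y : R, sgval y = sgval x * 'X_[h].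
  move=> /eqP x0; exists (sg (sgval x * 'X_[h])); rewrite sgK //.
  apply: semigroup_suppP => t; rewrite (perm_mem (msuppMX _ _)) => /mapP[r rx ->].
  have r0 : r != 0%MM by apply: contraTneq rx => ->; rewrite mcoeff_msupp x0 eqxx.
  have [a [r' [aA r'S ->]]] := submonoid_gen_split uA (sgvalP rx) r0.
  by rewrite addmA submonoid_genD // hA.
have [Hf HfE] := shift f (sP f (mem_head _ _)).
have [Hg HgE] : exists y : R, sgval y = sgval g * 'X_[h].
  by apply: shift; apply: sP; rewrite !inE eqxx orbT.
have f0 : sgval f != 0.
  apply/eqP => f0; have := reg 0%N isT 1; rewrite /= mulr1 !ideal_gen_nil.
  by move=> /(_ (sgval_inj (etrans f0 (esym (rmorph0 _)))))/eqP; rewrite oner_eq0.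
(* Since g (f t^h) = f (g t^h) lies in (f), regularity gives f t^h = f y with y in K[S]; cancelling
   f puts t^h in K[S]. *)
have := reg 1%N isT Hf; rewrite /= !ideal_gen1.
case; first by exists Hg; apply: sgval_inj; rewrite !rmorphM /= HfE HgE mulrCA.
move=> y /(congr1 sgval); rewrite rmorphM /= HfE => /(mulfI f0) hy.
by case/negP: hS; apply: (@sgvalP y); rewrite -hy msuppX mem_head.
Qed.

End PlaneSemigroupRing.

Local Close Scope ring_scope.

(** * The semigroup of the curve *)

(* For N > 2 and 0 < rho < N: e is a sum of j elements of {0, ..., N} other than
   rho. *)
Definition feasible (N rho j e : nat) : bool :=
  [&& e <= j * N, ~~ ((j == 1) && (e == rho)), (rho == 1) ==> (e != 1)
    & (rho == N.-1) ==> (e.+1 != j * N)].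

Lemma feasibleD N rho j e j' e' : 2 < N ->
  feasible N rho j e -> feasible N rho j' e' -> feasible N rho (j + j') (e + e').
Proof.
move=> N3; rewrite /feasible => /and4P[h1 h2 h3 h4] /and4P[k1 k2 k3 k4].
rewrite mulnDl.
apply/and4P; split; [lia| | lia|lia].
apply/negP => /andP[/eqP hj /eqP he].
have [j0|j0] : j = 0 \/ j' = 0 by lia.
  by subst j; move: h1 h2 k2; rewrite mul0n; lia.
by subst j'; move: k1 h2 k2; rewrite mul0n; lia.
Qed.

Lemma feasible1 N rho e : 0 < rho < N -> feasible N rho 1 e = (e <= N) && (e != rho).
Proof. rewrite /feasible mul1n; lia. Qed.

Lemma feasible0 N rho e : feasible N rho 0 e -> e = 0.
Proof. by rewrite /feasible mul0n leqn0 => /andP[/eqP]. Qed.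

(** The summand split off is 0 or N whenever the rest allows it. The exceptions have two summands:
    rho is split as 1 + (rho - 1), and N + rho as (N - 1) + (rho + 1). *)
Lemma feasibleS N rho j e : 2 < N -> 0 < rho < N -> 0 < j ->
    feasible N rho j.+1 e ->
  exists k, [/\ k <= e, k <= N, k != rho & feasible N rho j (e - k)].
Proof.
move=> N3 rhoN j0 /and4P[h1 h2 h3 h4].
have [j1|j1] := eqVneq j 1.
  subst j.
  suff [k] : exists k, [/\ k <= e, k <= N, k != rho,
    e - k <= N & e - k != rho].
    by move=> [? ? ? ? ?]; exists k; split=> //; rewrite feasible1 //; lia.
  have [eN|eN] := leqP e N.
    have [er|er] := eqVneq e rho; last by exists 0; split; lia.
    by exists 1; split; lia.
  have [er|er] := eqVneq (e - N) rho; last by exists N; split; lia.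
  by exists N.-1; split; lia.
have jN : 2 * N <= j * N by rewrite leq_mul2r; lia.
rewrite mulSn in h1 h4.
have [f|f] := boolP ((e <= j * N) && (feasible N rho j e)).
  by case/andP: f => ? ?; exists 0; split; rewrite ?subn0 //; lia.
exists N; split; rewrite /feasible in f *; lia.
Qed.

Section CurveSemigroup.
Variables (n m1 d r : nat).
Hypotheses (n_ge4 : 3 < n) (m1_gt0 : 0 < m1) (d_gt0 : 0 < d).
Hypotheses (r_ge2 : 1 < r) (r_le : r <= n - 1).

Local Notation A := (curve_gens_but n m1 d r).
Local Notation m := (arith_seq m1 d n).
Local Notation feas := (feasible n.-1 r.-1).

Lemma arith_seq_leq i : i <= n -> arith_seq m1 d i <= m.
Proof. by move=> ?; rewrite /arith_seq leq_add2l leq_mul2r; lia. Qed.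

Lemma curve_gen_inj : {in iota 1 n.+1 &, injective (curve_gen n m1 d)}.
Proof.
have E i : curve_gen n m1 d i ord0 = if i <= n then arith_seq m1 d i else 0.
  by rewrite /curve_gen; case: leqP => ?; rewrite ?mnm2_0 ?multinomE ?(tnth_nth 0).
move=> i j; rewrite !mem_iota => hi hj /(congr1 (fun t : 'X_{1..2} => t ord0)).
rewrite !E /arith_seq.
case: leqP => hi'; case: leqP => hj'; try lia.
move=> h; have : (i - 1) * d = (j - 1) * d by lia.
by move/eqP; rewrite eqn_mul2r; lia.
Qed.

Lemma curve_gen_le i : i <= n ->
  curve_gen n m1 d i = mnm2 (arith_seq m1 d i) (m - arith_seq m1 d i).
Proof. by rewrite /curve_gen => ->. Qed.

Lemma curve_gen_last : curve_gen n m1 d n.+1 = mnm2 0 m.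
Proof. by rewrite /curve_gen ltnn. Qed.

Lemma uniq_curve_gens_but : uniq A.
Proof.
by rewrite filter_uniq // map_inj_in_uniq ?iota_uniq //; apply: curve_gen_inj.
Qed.

Lemma mem_curve_gens_but i : 0 < i <= n.+1 -> i != r -> curve_gen n m1 d i \in A.
Proof.
move=> hi ir; rewrite mem_filter map_f ?mem_iota ?andbT; last by lia.
by apply: contra ir => /eqP/curve_gen_inj ->; rewrite ?mem_iota //; lia.
Qed.

Lemma curve_gens_butP a : a \in A ->
  exists2 i, 0 < i <= n.+1 & i != r /\ a = curve_gen n m1 d i.
Proof.
rewrite mem_filter => /andP[ar /mapP[i]]; rewrite mem_iota => hi ai.
exists i; first by lia.
by split=> //; apply: contra_neq ar => <-.
Qed.

(** D counts the generators used, j those other than (0, m), and e is the sum of i - 1 over the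
    latter. *)
Definition curve_point (s : 'X_{1..2}) : Prop :=
  exists D j e, [/\ j <= D, feas j e, s ord0 = j * m1 + e * d
    & s ord0 + s ord_max = D * m].

Lemma submonoid_genP s : s \in submonoid_gen A <-> curve_point s.
Proof.
have mE : m = m1 + n.-1 * d by rewrite /arith_seq subn1.
split.
  apply: (submonoid_gen_ind (P := curve_point)) => {s} [|s t|a].
  - by exists 0, 0, 0; rewrite /feasible mul0n !mnmE; split=> //; lia.
  - move=> [D [j [e [h1 h2 h3 h4]]]] [D' [j' [e' [h1' h2' h3' h4']]]].
    exists (D + D'), (j + j'), (e + e'); rewrite !mnmDE.
    rewrite feasibleD //; last by lia.
    by split=> //; [lia|rewrite h3 h3'; lia|rewrite mulnDl; lia].
  - move=> /curve_gens_butP[i hi [ir ->]].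
    have [hin|hin] := leqP i n; rewrite ?(curve_gen_le hin).
      exists 1, 1, i.-1; rewrite feasible1; last by lia.
      split=> //; rewrite ?mnm2E /= ?/arith_seq; try lia.
        by have := arith_seq_leq hin; rewrite /arith_seq; lia.
    have -> : i = n.+1 by lia.
    rewrite curve_gen_last; exists 1, 0, 0.
    by split=> //; rewrite ?mnm2E /= /feasible; lia.
move=> [D [j [e []]]].
have mA i : 0 < i <= n.+1 -> i != r -> curve_gen n m1 d i \in submonoid_gen A.
  move=> ? ?; apply/submonoid_gen_mem/mem_curve_gens_but => //.
  exact: uniq_curve_gens_but.
have top : mnm2 0 m \in submonoid_gen A.
  by rewrite -curve_gen_last; apply: mA; lia.
have bot k : k <= n.-1 -> k != r.-1 ->
    mnm2 (m1 + k * d) (m - (m1 + k * d)) \in submonoid_gen A.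
  move=> ? ?; have := mA k.+1; rewrite curve_gen_le /arith_seq ?subSS ?subn0; last by lia.
  by apply; lia.
(* Each step splits off a generator a_(k+1); once j = 0, only copies of (0, m) remain. *)
elim: j D e s => [|j IH] D e s jD fe s0 s1.
  rewrite (feasible0 fe) in s0.
  rewrite (_ : s = ((mnm2 0 m) *+ D)%MM); first exact: submonoid_gen_mulmn.
  by apply: mnm2P; rewrite !mnm2E; lia.
have [k [ke kN kr fk]] : exists k, [/\ k <= e, k <= n.-1, k != r.-1
   & feas j (e - k)].
  case: (posnP j) => j0; last by apply: feasibleS => //; lia.
  subst j; rewrite feasible1 in fe; last by lia.
  exists e; rewrite subnn /feasible; split; lia.
have kd : k * d <= n.-1 * d by rewrite leq_mul2r kN orbT.
have kd' : k * d <= e * d by rewrite leq_mul2r ke orbT.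
case: D => [//|D] in jD s1 *.
have bnd : (e - k) * d <= j * n.-1 * d.
  by rewrite leq_mul2r; case/and4P: fk => -> _ _ _; rewrite orbT.
have jD' : j * (m1 + n.-1 * d) <= D * m by rewrite -mE leq_mul2r; lia.
set s' := mnm2 (j * m1 + (e - k) * d) (D * m - (j * m1 + (e - k) * d)).
rewrite (_ : s = (mnm2 (m1 + k * d) (m - (m1 + k * d)) + s')%MM).
  apply: submonoid_genD; first exact: bot.
  apply: (IH D (e - k)) => //; rewrite /s' !mnm2E; nia.
apply: mnm2P; rewrite mnmDE /s' !mnm2E.
  by rewrite s0 mulnBl; lia.
rewrite mulnDr in jD'; rewrite -mulnA in bnd.
move: s0 s1; rewrite !mulSn => s0 s1; rewrite mulnBl in bnd *; lia.
Qed.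

Lemma curve_vertices : mnm2 m 0 \in submonoid_gen A /\ mnm2 0 m \in submonoid_gen A.
Proof.
split; apply: (submonoid_gen_mem uniq_curve_gens_but).
  by rewrite -[X in mnm2 _ X](subnn m) -curve_gen_le // mem_curve_gens_but //; lia.
by rewrite -curve_gen_last mem_curve_gens_but //; lia.
Qed.

(** * Exchange of representations, and the condition on S for the curve *)

Hypothesis cop : coprime m1 d.

Lemma exchange j e j' e' : j * m1 + e * d = j' * m1 + e' * d -> j <= j' ->
  exists t, j' = j + t * d /\ e = e' + t * m1.
Proof.
move=> E jj'; have jm : j * m1 <= j' * m1 by rewrite leq_mul2r jj' orbT.
have E1 : e * d = e' * d + (j' - j) * m1 by rewrite mulnBl; lia.
have ee' : e' <= e by rewrite -(leq_pmul2r d_gt0); lia.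
have : d %| (j' - j) * m1.
  have -> : (j' - j) * m1 = (e - e') * d by rewrite [RHS]mulnBl E1 addKn.
  exact: dvdn_mull.
rewrite Gauss_dvdl 1?coprime_sym // => /dvdnP[t jt].
exists t; split; first by lia.
by apply/eqP; rewrite -(eqn_pmul2r d_gt0) E1 jt mulnDl mulnAC.
Qed.

Lemma curve_criterion (s : 'X_{1..2}) i j : r <= m1 \/ r = n - 1 ->
  (s + mnm2 m 0 *+ i)%MM \in submonoid_gen A ->
  (s + mnm2 0 m *+ j)%MM \in submonoid_gen A -> s \in submonoid_gen A.
Proof.
have mE : m = m1 + n.-1 * d by rewrite /arith_seq subn1.
have m_gt0 : 0 < m by rewrite mE addn_gt0 m1_gt0.
move=> hr /submonoid_genP[D1 [j1 [e1 [jD1 f1 x1 y1]]]].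
move=> /submonoid_genP[D2 [j2 [e2 [jD2 f2 x2 y2]]]].
rewrite !mnm2E ?mul0n ?addn0 in x1 x2 y1 y2.
have D1i : i <= D1 by rewrite -(leq_pmul2r m_gt0); lia.
have D2j : j <= D2 by rewrite -(leq_pmul2r m_gt0); lia.
have D12 : D1 - i = D2 - j.
  by apply/eqP; rewrite -(eqn_pmul2r m_gt0) !mulnBl; lia.
set D := D1 - i in D12; apply/submonoid_genP.
have xyD : s ord0 + s ord_max = D * m by rewrite mulnBl; lia.
(* The pair (j2, e2) already has the abscissa of s and fails only if j2 exceeds the degree D of
   s. *)
have [jD|Dj] := leqP j2 D; first by exists D, j2, e2; split=> //; lia.
have E1 : e1 <= j1 * n.-1 by case/and4P: f1.
have ji : i <= j1.
  rewrite -(leq_pmul2r m_gt0) [X in _ <= _ * X]mE mulnDr mulnA.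
  have : e1 * d <= j1 * n.-1 * d by rewrite leq_mul2r E1 orbT.
  by lia.
have Ex : (j1 - i) * m1 + e1 * d = j2 * m1 + (e2 + i * n.-1) * d.
  move: x1; rewrite mE mulnDl mulnBl; nia.
have [t [jt et]] := exchange Ex (leq_trans (leq_sub2r i jD1) (ltnW Dj)).
have t0 : 0 < t by case: t jt {et} => //; rewrite /D in Dj; lia.
have tm : m1 <= t * m1 by rewrite leq_pmull.
(* This is (j1 - i, e1 - i N), and t > 0 makes its second entry at least m1. If r <= m1, it exceeds
   rho; if rho = N - 1, a missing value here would make e1 = j1 N - 1, missing as well. *)
exists D, (j1 - i), (e2 + t * m1); split=> //; first by lia.
- case/and4P: f1 => _ f12 f13 f14; rewrite /feasible mulnBl.
  have jin : i * n.-1 <= j1 * n.-1 by rewrite leq_mul2r ji orbT.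
  apply/and4P; split; [lia| | | by case: hr; lia]; last by case: hr; lia.
  apply/negP => /andP[/eqP j1i /eqP ee].
  have : j1 * n.-1 = i.+1 * n.-1 by have -> : j1 = i.+1 by lia.
  by rewrite mulSn; case: hr; lia.
- apply/eqP; rewrite -(eqn_add2r (i * (n.-1 * d))); apply/eqP.
  nia.
Qed.

Lemma curve_gap : ~ (r <= m1 \/ r = n - 1) ->
  exists h, h \notin submonoid_gen A /\
    forall a, a \in A -> (h + a)%MM \in submonoid_gen A.
Proof.
have mE : m = m1 + n.-1 * d by rewrite /arith_seq subn1.
have m_gt0 : 0 < m by rewrite mE addn_gt0 m1_gt0.
move=> hr.
(* The x-coordinate j * m1 + rho * d has the representations (j, rho), which is
   excluded, and (j + d, rho - m1), which needs degree j + d.  If rho = 1, then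
   m1 = 1 and j = d: adding the generator a_1 gives (d + 1, 1), excluded again,
   but also (1, 2). *)
pose j := if r == 2 then d else 1.
(* One less than the degree required by the second representation. *)
pose D := j + d - 1.
have jd : j <= d by rewrite /j; case: ifP.
have j0 : 0 < j by rewrite /j; case: ifP.
have jr : j = 1 \/ r = 2 by rewrite /j; case: eqP; [right|left].
have xle : j * m1 + r.-1 * d <= D * m.
  have : j * (m1 + n.-1 * d) <= D * m by rewrite -mE leq_mul2r /D; lia.
  have : r.-1 * d <= n.-1 * d by rewrite leq_mul2r; lia.
  have : n.-1 * d <= j * (n.-1 * d) by rewrite leq_pmull.
  by rewrite mulnDr; lia.
exists (mnm2 (j * m1 + r.-1 * d) (D * m - (j * m1 + r.-1 * d))); split.
  apply/negP => /submonoid_genP[D' [j' [e' [jD' fe]]]]; rewrite !mnm2E subnKC //.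
  move=> x' /eqP; rewrite eqn_pmul2r // => /eqP DD; subst D'.
  (* Any representation has j' = j + t d or j' = j - t d. The bound D leaves only t = 0 in the first
     case; in the second j' = 0, which forces e' = 0. *)
  have [jj|jj] := leqP j j'.
    have [t [jt et]] := exchange x' jj.
    have t0 : t = 0 by case: t jt {et} => // t; rewrite mulSn /D in jD' *; lia.
    by move: fe; rewrite jt et t0 /feasible; case: jr; lia.
  have [t [jt et]] := exchange (esym x') (ltnW jj).
  have t1 : t = 1.
    case: t jt {et} => [|[|t]]; rewrite ?mulSn; lia.
  have jd' : j' = 0 by rewrite t1 in jt; lia.
  by move: fe; rewrite jd' => /feasible0; lia.
move=> a /curve_gens_butP[i hi [ir ->]]; apply/submonoid_genP.
have [hin|hin] := leqP i n; last first.
  have -> : i = n.+1 by lia.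
  (* Adding (0, m) raises the degree to j + d, so the exchanged representation becomes available. *)
  rewrite curve_gen_last; exists D.+1, (j + d), (r.-1 - m1).
  rewrite !mnm2E addn0; split; [rewrite /D; lia| | | lia].
    have /= : 2 * n.-1 <= (j + d) * n.-1 by rewrite leq_mul2r; lia.
    rewrite /feasible; lia.
  by rewrite mulnDl mulnBl; nia.
rewrite (curve_gen_le hin).
have miE : arith_seq m1 d i = m1 + i.-1 * d by rewrite /arith_seq subn1.
have mile : m1 + i.-1 * d <= m by rewrite -miE; apply: arith_seq_leq.
have [/andP[/eqP r2 /eqP i1]|ri] := boolP ((r == 2) && (i == 1)).
  have m11 : m1 = 1 by lia.
  have jE : j = d by rewrite /j r2.
  exists D.+1, 1, 2; rewrite !mnm2E miE r2 i1 jE m11.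
  split; [rewrite /D; lia| | lia |].
    by rewrite /feasible; lia.
  by move: xle mile; rewrite mulSn r2 i1 jE m11; lia.
(* With at least two summands and rho < N - 1, only the value 1 for rho = 1 could be missing, and
   that is the case i = 1 treated above. *)
exists D.+1, j.+1, (r.-1 + i.-1).
rewrite !mnm2E miE; split; [rewrite /D; lia| | | rewrite mulSn; lia].
  have : 2 * n.-1 <= j.+1 * n.-1 by rewrite leq_mul2r; lia.
  rewrite /feasible; lia.
by rewrite mulSn mulnDl; lia.
Qed.

End CurveSemigroup.

Theorem corollary5 (K : fieldType) (n m1 d r : nat)
    (infK : infinite_set [set: K]%classic) (n_ge4 : 4 <= n)
    (m1_gt0 : 0 < m1) (d_gt0 : 0 < d) (cop_m1d : coprime m1 d)
    (r_ge2 : 2 <= r) (r_le : r <= n - 1) :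
  cohen_macaulay (semigroup_ring K (curve_gens_but n m1 d r)) <->
  r <= m1 \/ r = n - 1.
Proof.
have m_gt0 : 0 < arith_seq m1 d n by rewrite addn_gt0 m1_gt0.
have uA : uniq (curve_gens_but n m1 d r) by apply: uniq_curve_gens_but.
have [uS vS] : mnm2 (arith_seq m1 d n) 0 \in submonoid_gen (curve_gens_but n m1 d r) /\
    mnm2 0 (arith_seq m1 d n) \in submonoid_gen (curve_gens_but n m1 d r).
  exact: curve_vertices.
split=> [CM|hr].
  apply: contrapT => hr.
  have [//|//|//|//|//|//|h [hS hA]] := @curve_gap n m1 d r _ _ _ _ _ _ hr.
  exact: sg_not_cohen_macaulay m_gt0 uS vS uA hS hA CM.
apply: (sg_cohen_macaulay K m_gt0 uS vS) => s i j.
exact: curve_criterion hr.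
Qed.
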